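(* Let $N\ge 2$ and let $\varrho$ be an entangled state (density matrix) of $N$ qubits on $(\mathbb{C}^2)^{\otimes N}$, shared by $N$ observers $\mathcal{O}_1,\mathcal{O}_2,\dots,\mathcal{O}_N$, where $\mathcal{O}_k$ holds the $k$-th qubit. Suppose that there exist at least two observers each of whom is able to steer the remaining $N-1$ qubits into two different pure states by performing some orthogonal projective measurement on his/her own qubit (the measurement may be different for different observers). Then $\varrho$ violates local realism.
   Context: An $N$-qubit state is a positive semidefinite trace-one operator $\varrho$ on $(\mathbb{C}^2)^{\otimes N}$ (not necessarily of rank one). It is entangled if it is not fully separable, i.e. not a convex combination of product states $\rho_1\otimes\cdots\otimes\rho_N$. Orthogonal projective measurement on a qubit: a pair of rank-one projectors $\{\mathcal{P}^0,\mathcal{P}^1\}$ onto the two vectors of an orthonormal basis of $\mathbb{C}^2$. Steering into two different pure states: observer $\mathcal{O}_k$ can steer the remaining $N-1$ qubits into two different pure states by the measurement $\{\mathcal{P}^0,\mathcal{P}^1\}$ on the $k$-th qubit if, for each $a\in\{0,1\}$, writing $\mathcal{P}^a_{(k)}$ for $\mathcal{P}^a$ acting on the $k$-th qubit tensored with the identity on all other qubits, the outcome probability $p_a=\mathrm{tr}[\mathcal{P}^a_{(k)}\varrho]$ is nonzero and the normalized conditional state of the other $N-1$ qubits, $p_a^{-1}\,\mathrm{tr}_k[\mathcal{P}^a_{(k)}\varrho]$ (with $\mathrm{tr}_k$ the partial trace over the $k$-th qubit), is a pure state (a rank-one projector on $(\mathbb{C}^2)^{\otimes (N-1)}$), and the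 two pure states obtained for $a=0$ and $a=1$ are different. Violation of local realism: $\varrho$ violates local realism if there are finitely many projective measurements for each observer, indexed by settings $i_k$ for $\mathcal{O}_k$, such that the quantum probabilities $p(a_1,\dots,a_N|i_1,\dots,i_N)=\mathrm{tr}[(\mathcal{P}^{a_1}_{1,i_1}\otimes\cdots\otimes\mathcal{P}^{a_N}_{N,i_N})\varrho]$ admit no local hidden variable model, i.e. cannot be written as $\int d\mu(\lambda)\prod_{k=1}^N p_k(a_k|i_k,\lambda)$ with $\mu$ a probability measure and each $p_k(\cdot|i_k,\lambda)$ a probability distribution. Equivalently, some $N$-party Bell inequality (an inequality satisfied by all local hidden variable models) is violated by $\varrho$ for some choice of local projective measurements. (A setting in which an observer performs no measurement, i.e. the identity is measured, is allowed.) *)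

(* Defs.v *)
From mathcomp Require Import all_boot all_order all_algebra.
From mathcomp Require Import spectral sesquilinear.
From mathcomp.real_closed Require Import complex.
From mathcomp Require Import all_classical all_reals all_analysis.

Set Implicit Arguments.
Unset Strict Implicit.
Unset Printing Implicit Defensive.

Import Order.TTheory GRing.Theory Num.Theory.

Local Open Scope ring_scope.
Local Open Scope complex_scope.
Local Open Scope sesquilinear_scope.

(* Computational basis of (C^2)^{(x) N}. *)
Definition qbasis (N : nat) := {ffun 'I_N -> 'I_2}.

(* Operators on (C^2)^{(x) N}, as matrices in the computational basis; a basis
   element s is turned into a matrix index by [enum_rank s]. *)
Definition qop (R : realType) (N : nat) := 'M[R[i]]_#|{: qbasis N}|.

Definition tensor_op (R : realType) (N : nat) (A : 'I_N -> 'M[R[i]]_2) :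
    qop R N :=
  \matrix_(x, y) \prod_(k < N) A k ((enum_val x : qbasis N) k) ((enum_val y : qbasis N) k).

Definition local_op (R : realType) (N : nat) (k : 'I_N) (A : 'M[R[i]]_2) :
    qop R N :=
  tensor_op (fun j => if j == k then A else 1%:M).

(* The basis element of N qubits with value a at qubit k, the other N - 1
   qubits being given, in increasing order, by s. *)
Definition insert_qubit (N : nat) (k : 'I_N) (a : 'I_2) (s : qbasis N.-1) :
    qbasis N :=
  [ffun j => if unlift k j is Some j' then s j' else a].

Definition partial_trace (R : realType) (N : nat) (k : 'I_N) (X : qop R N) :
    qop R N.-1 :=
  \matrix_(x, y) \sum_(a < 2)
    X (enum_rank (insert_qubit k a (enum_val x)))
      (enum_rank (insert_qubit k a (enum_val y))).

(* In R[i], 0 <= z means that z is real and nonnegative. *)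
Definition psd (R : realType) (n : nat) (A : 'M[R[i]]_n) : Prop :=
  A \is hermsymmx /\ forall v : 'cV[R[i]]_n, 0 <= (v ^t* *m A *m v) 0 0.

Definition density (R : realType) (n : nat) (A : 'M[R[i]]_n) : Prop :=
  psd A /\ \tr A = 1.

Definition pure_state (R : realType) (n : nat) (A : 'M[R[i]]_n) : Prop :=
  [/\ A \is hermsymmx, A *m A = A & \rank A = 1%N].

Definition fully_separable (R : realType) (N : nat) (rho : qop R N) : Prop :=
  exists (m : nat) (w : 'I_m -> R) (sigma : 'I_m -> 'I_N -> 'M[R[i]]_2),
    [/\ forall i, 0 <= w i,
        \sum_(i < m) w i = 1,
        forall i k, density (sigma i k)
      & rho = \sum_(i < m) (w i)%:C *: tensor_op (sigma i)].

Definition entangled (R : realType) (N : nat) (rho : qop R N) : Prop :=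
  ~ fully_separable rho.

Definition projective_measurement (R : realType) (P : 'I_2 -> 'M[R[i]]_2) :
    Prop :=
  exists u : 'I_2 -> 'cV[R[i]]_2,
    (forall a b, (u a) ^t* *m u b = (a == b)%:R%:M) /\
    (forall a, P a = u a *m (u a) ^t*).

Definition outcome_prob (R : realType) (N : nat) (rho : qop R N) (k : 'I_N)
    (P : 'I_2 -> 'M[R[i]]_2) (a : 'I_2) : R[i] :=
  \tr (local_op k (P a) *m rho).

Definition conditional_state (R : realType) (N : nat) (rho : qop R N)
    (k : 'I_N) (P : 'I_2 -> 'M[R[i]]_2) (a : 'I_2) : qop R N.-1 :=
  (outcome_prob rho k P a)^-1 *: partial_trace k (local_op k (P a) *m rho).

Definition can_steer (R : realType) (N : nat) (rho : qop R N) (k : 'I_N) :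
    Prop :=
  exists P : 'I_2 -> 'M[R[i]]_2,
    [/\ projective_measurement P,
        forall a, outcome_prob rho k P a <> 0,
        forall a, pure_state (conditional_state rho k P a)
      & conditional_state rho k P ord0 <> conditional_state rho k P ord_max].

(* Measuring the identity: outcome 0 occurs with certainty. *)
Definition no_measurement (R : realType) (P : 'I_2 -> 'M[R[i]]_2) : Prop :=
  P ord0 = 1%:M /\ P ord_max = 0.

Definition local_setting (R : realType) (P : 'I_2 -> 'M[R[i]]_2) : Prop :=
  projective_measurement P \/ no_measurement P.

(* Observer k has m k settings; P k i a is the effect of outcome a in setting
   i of observer k. *)
Definition joint_prob (R : realType) (N : nat) (rho : qop R N) (m : 'I_N -> nat)
    (P : forall k : 'I_N, 'I_(m k) -> 'I_2 -> 'M[R[i]]_2)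
    (i : forall k : 'I_N, 'I_(m k)) (a : 'I_N -> 'I_2) : R[i] :=
  \tr (tensor_op (fun k => P k (i k) (a k)) *m rho).

Definition has_lhv_model (R : realType) (N : nat) (m : 'I_N -> nat)
    (p : (forall k : 'I_N, 'I_(m k)) -> ('I_N -> 'I_2) -> R[i]) : Prop :=
  exists (d : measure_display) (T : measurableType d) (mu : probability T R)
      (q : forall k : 'I_N, 'I_(m k) -> 'I_2 -> T -> R),
    [/\ forall k i a, measurable_fun setT (q k i a),
        forall k i a l, 0 <= q k i a l,
        forall k i l, \sum_(a < 2) q k i a l = 1
      & forall i a,
          p i a = (\int[mu]_(l in setT) \prod_(k < N) q k (i k) (a k) l)%:C].

Definition violates_local_realism (R : realType) (N : nat) (rho : qop R N) :
    Prop :=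
  exists (m : 'I_N -> nat)
      (P : forall k : 'I_N, 'I_(m k) -> 'I_2 -> 'M[R[i]]_2),
    (forall k i, local_setting (P k i)) /\ ~ has_lhv_model (joint_prob rho P).

(* Main.v *)
Require Import Defs.
From mathcomp Require Import all_boot all_order all_algebra.
From mathcomp Require Import spectral sesquilinear.
From mathcomp.real_closed Require Import complex.
From mathcomp Require Import all_classical all_reals all_analysis.
From mathcomp Require Import ring.

(* Steering into pure states by observer [k], together with positivity, confines
   [rho] to the span of two orthonormal vectors [e a] = [u a] (x) [phi a].  If
   [rho] has rank one it is a pure entangled state.  If it has rank two, the two
   steering observers [k] and [l] must single out the same pair of vectors, so
   that [rho] is a combination of the four dyads of |0 0 chi_0> and |1 1 chi_1>
   (qubits [k] and [l] first).  When the coefficient of the off-diagonal dyads is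
   nonzero, project the other qubits on a product vector that overlaps both
   [chi a]; when it vanishes, one of the two vectors must be entangled
   and can be isolated by measuring qubit [k].

   An entangled pure state always has two qubits [i], [j] and a product vector of
   the other qubits onto which projecting leaves [i], [j] entangled; by the
   singular value decomposition the projected state is again of the form
   p |00><00| + q |11><11| + d |00><11| + d^* |11><00| with [d] nonzero.
   Such a state violates the Clauser-Horne inequality, conditioned on the
   outcomes of the other observers. *)

Set Implicit Arguments.
Unset Strict Implicit.
Unset Printing Implicit Defensive.

Import Order.TTheory GRing.Theory Num.Theory.

Local Open Scope ring_scope.
Local Open Scope sesquilinear_scope.

(** * Adjoints and positive semidefinite matrices *)

Section Adjoint.
Variable C : numClosedFieldType.
Implicit Types m n p : nat.

Lemma trmxCM m n p (A : 'M[C]_(m, n)) (B : 'M[C]_(n, p)) :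
  (A *m B)^t* = B^t* *m A^t*.
Proof. by rewrite trmx_mul map_mxM. Qed.

Lemma trmxCD m n (A B : 'M[C]_(m, n)) : (A + B)^t* = A^t* + B^t*.
Proof. by rewrite linearD map_mxD. Qed.

Lemma trmxCZ m n a (A : 'M[C]_(m, n)) : (a *: A)^t* = a^* *: A^t*.
Proof. by rewrite linearZ map_mxZ. Qed.

Lemma trmxC0 m n : (0 : 'M[C]_(m, n))^t* = 0.
Proof. by rewrite trmx0 map_mx0. Qed.

Lemma trmxC1 n : (1%:M : 'M[C]_n)^t* = 1%:M.
Proof. by rewrite trmx1 map_mx1. Qed.

Lemma trmxCE m n (A : 'M[C]_(m, n)) i j : A^t* i j = (A j i)^*.
Proof. by rewrite !mxE. Qed.

Lemma hermsymE n (A : 'M[C]_n) : (A \is hermsymmx) = (A^t* == A).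
Proof. by rewrite is_hermitianmxE expr0 scale1r eq_sym. Qed.

Lemma mul11 (A B : 'M[C]_1) : (A *m B) 0 0 = A 0 0 * B 0 0.
Proof. by rewrite !mxE big_ord1. Qed.

Lemma add11 (A B : 'M[C]_1) : (A + B) 0 0 = A 0 0 + B 0 0.
Proof. by rewrite mxE. Qed.

Lemma scale11 a (A : 'M[C]_1) : (a *: A) 0 0 = a * A 0 0.
Proof. by rewrite mxE. Qed.

Lemma dot_conj n (u v : 'cV[C]_n) :
  (u^t* *m v) 0 0 = ((v^t* *m u) 0 0)^*.
Proof. by rewrite -trmxCE trmxCM trmxCK. Qed.

Lemma dotE n (u v : 'cV[C]_n) : (u^t* *m v) 0 0 = \sum_i (u i 0)^* * v i 0.
Proof. by rewrite !mxE; apply: eq_bigr => i _; rewrite !mxE. Qed.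

Lemma dot_ge0 n (v : 'cV[C]_n) : 0 <= (v^t* *m v) 0 0.
Proof.
rewrite dotE; apply: sumr_ge0 => i _.
by rewrite mulrC mul_conjC_ge0.
Qed.

Lemma dot_eq0 n (v : 'cV[C]_n) : ((v^t* *m v) 0 0 == 0) = (v == 0).
Proof.
apply/idP/eqP => [|->]; last by rewrite mulmx0 mxE.
rewrite dotE psumr_eq0 => [/allP h|i _]; last by rewrite mulrC mul_conjC_ge0.
apply/matrixP => i j; rewrite ord1 mxE.
have := h i (mem_index_enum _); rewrite mulrC mul_conjC_eq0.
by move/eqP.
Qed.

(** With [w = A *m v], the form at [v + t *: w] is [2 * t * b + t ^+ 2 * a], where [b] is the
    squared norm of [w]; for a small negative [t] it would be negative unless [b = 0]. *)
Lemma psd_ker_col n (A : 'M[C]_n) (v : 'cV[C]_n) :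
  A^t* = A -> (forall w : 'cV[C]_n, 0 <= (w^t* *m A *m w) 0 0) ->
  (v^t* *m A *m v) 0 0 = 0 -> A *m v = 0.
Proof.
move=> hA pA v0; set w := A *m v; apply/eqP; rewrite -dot_eq0.
set b := (w^t* *m w) 0 0; set a := (w^t* *m A *m w) 0 0.
have hb : 0 <= b by exact: dot_ge0.
have ha : 0 <= a by exact: pA.
have br : b^* = b by rewrite conj_Creal // ger0_real.
have key t : t^* = t -> 0 <= 2 * (t * b) + t ^+ 2 * a.
  move=> tr; have := pA (v + t *: w).
  rewrite trmxCD trmxCZ !mulmxDl !mulmxDr -!scalemxAl -!scalemxAr.
  rewrite !(add11, scale11) v0 add0r tr -/a.
  have -> : ((v^t* *m A) *m w) 0 0 = b.
    by rewrite -{1}hA -trmxCM.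
  have -> : ((w^t* *m A) *m v) 0 0 = b by rewrite -mulmxA.
  by congr (0 <= _); ring.
have [//|bN0] := eqVneq b 0.
have bp : 0 < b by rewrite lt_neqAle eq_sym bN0.
have a1 : 0 < a + 1 by rewrite ltr_wpDl.
(* The value [t = - b / (a + 1)] is negative enough for every [a >= 0]; the added 1 covers
   [a = 0]. *)
have tr : (- (b / (a + 1)))^* = - (b / (a + 1)).
  by rewrite conj_Creal // rpredN ger0_real // divr_ge0 // ltW.
have := key _ tr.
have -> : 2 * (- (b / (a + 1)) * b) + (- (b / (a + 1))) ^+ 2 * a
     = - (b ^+ 2 * (a + 2) / (a + 1) ^+ 2).
  by field; rewrite gt_eqF.
rewrite oppr_ge0 => h; exfalso; move: h; apply/negP; rewrite -real_ltNge ?real0 //.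
  by rewrite divr_gt0 ?exprn_gt0 // mulr_gt0 ?exprn_gt0 // ltr_wpDl // ltr0n.
rewrite ger0_real // ltW // divr_gt0 ?exprn_gt0 // mulr_gt0 ?exprn_gt0 //.
by rewrite ltr_wpDl // ltr0n.
Qed.

End Adjoint.

(** * Product vectors and tensor operators, one qubit slot at a time *)

Section ProductVectors.
Variables (R : realType) (N : nat).
Local Notation C := (complex R).
Implicit Types (x y : 'I_N -> 'cV[C]_2) (A B : 'I_N -> 'M[C]_2).
Implicit Type s : qbasis N.

Definition prodvec x : 'cV[C]_#|{: qbasis N}| :=
  \col_i \prod_(k < N) x k ((enum_val i : qbasis N) k) 0.

(** Distributivity over basis strings; it reduces products and traces of tensor operators to
    single-qubit ones. *)
Lemma sum_qbasis (F : 'I_N -> 'I_2 -> C) :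
  \sum_(i < #|{: qbasis N}|) \prod_k F k ((enum_val i : qbasis N) k) =
  \prod_k \sum_b F k b.
Proof.
rewrite bigA_distr_bigA /=.
rewrite [RHS](reindex (fun i : 'I_#|{: qbasis N}| => enum_val i : qbasis N)) //=.
exact: onW_bij (enum_val_bij _).
Qed.

Lemma mul_tensor_prodvec A x :
  tensor_op A *m prodvec x = prodvec (fun k => A k *m x k).
Proof.
apply/matrixP => i j; rewrite !mxE.
under eq_bigr => l _ do rewrite !mxE -big_split /=.
rewrite (sum_qbasis (fun k b => A k ((enum_val i : qbasis N) k) b * x k b 0)).
by apply: eq_bigr => k _; rewrite mxE.
Qed.

Lemma mul_tensor_op A B :
  tensor_op A *m tensor_op B = tensor_op (fun k => A k *m B k).
Proof.
apply/matrixP => i j; rewrite !mxE.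
under eq_bigr => l _ do rewrite !mxE -big_split /=.
rewrite (sum_qbasis (fun k b => A k ((enum_val i : qbasis N) k) b
                              * B k b ((enum_val j : qbasis N) k))).
by apply: eq_bigr => k _; rewrite mxE.
Qed.

Lemma prodvec_adj x y :
  prodvec x *m (prodvec y)^t* = tensor_op (fun k => x k *m (y k)^t*).
Proof.
apply/matrixP => i j; rewrite !mxE big_ord1 !mxE rmorph_prod -big_split /=.
by apply: eq_bigr => k _; rewrite !mxE big_ord1 !mxE.
Qed.

Lemma tensor_op_adj A : (tensor_op A)^t* = tensor_op (fun k => (A k)^t*).
Proof.
apply/matrixP => i j; rewrite !mxE rmorph_prod.
by apply: eq_bigr => k _; rewrite !mxE.
Qed.

Lemma tensor_opZ (c : 'I_N -> C) A :
  tensor_op (fun k => c k *: A k) = (\prod_k c k) *: tensor_op A.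
Proof.
apply/matrixP => i j; rewrite !mxE -big_split /=.
by apply: eq_bigr => k _; rewrite mxE.
Qed.

Definition upd (T : Type) (x : 'I_N -> T) (k : 'I_N) (v : T) : 'I_N -> T :=
  fun j => if j == k then v else x j.

Lemma upd_same T (x : 'I_N -> T) k v : upd x k v k = v.
Proof. by rewrite /upd eqxx. Qed.

Lemma upd_other T (x : 'I_N -> T) k v j : j != k -> upd x k v j = x j.
Proof. by rewrite /upd => /negPf ->. Qed.

Lemma upd_id T (x : 'I_N -> T) k : upd x k (x k) = x.
Proof. by apply/funext => j; rewrite /upd; case: eqP => // ->. Qed.

Lemma upd_upd T (x : 'I_N -> T) k v w : upd (upd x k v) k w = upd x k w.
Proof. by apply/funext => j; rewrite /upd; case: eqP. Qed.

Lemma updC T (x : 'I_N -> T) k l v w : k != l ->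
  upd (upd x k v) l w = upd (upd x l w) k v.
Proof.
move=> kl; apply/funext => j; rewrite /upd.
by case: (eqVneq j l) => // ->; rewrite eq_sym (negPf kl).
Qed.

Lemma prod_upd T (F : 'I_N -> T -> C) (x : 'I_N -> T) k v :
  \prod_l F l (upd x k v l) = F k v * \prod_(l | l != k) F l (x l).
Proof.
rewrite (bigD1 k) //= upd_same; congr (_ * _).
by apply: eq_bigr => l lk; rewrite upd_other.
Qed.

Lemma prodvec_upd x k v i :
  prodvec (upd x k v) i 0 = v ((enum_val i : qbasis N) k) 0 *
    \prod_(l | l != k) x l ((enum_val i : qbasis N) l) 0.
Proof.
by rewrite mxE (prod_upd (fun l (z : 'cV[C]_2) => z ((enum_val i : qbasis N) l) 0)).
Qed.

Lemma tensor_op_upd A k X i j :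
  tensor_op (upd A k X) i j =
    X ((enum_val i : qbasis N) k) ((enum_val j : qbasis N) k) *
    \prod_(l | l != k) A l ((enum_val i : qbasis N) l) ((enum_val j : qbasis N) l).
Proof.
by rewrite mxE (prod_upd (fun l (z : 'M[C]_2) =>
  z ((enum_val i : qbasis N) l) ((enum_val j : qbasis N) l))).
Qed.

Lemma prodvecD x k v w :
  prodvec (upd x k (v + w)) = prodvec (upd x k v) + prodvec (upd x k w).
Proof.
by apply/matrixP => i j; rewrite ord1 [RHS]mxE !prodvec_upd mxE mulrDl.
Qed.

Lemma prodvec_updZ x k c v : prodvec (upd x k (c *: v)) = c *: prodvec (upd x k v).
Proof.
by apply/matrixP => i j; rewrite ord1 [RHS]mxE !prodvec_upd mxE mulrA.
Qed.

Lemma tensor_opD A k X Y :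
  tensor_op (upd A k (X + Y)) = tensor_op (upd A k X) + tensor_op (upd A k Y).
Proof.
by apply/matrixP => i j; rewrite [RHS]mxE !tensor_op_upd mxE mulrDl.
Qed.

Lemma tensor_op_updZ A k c X :
  tensor_op (upd A k (c *: X)) = c *: tensor_op (upd A k X).
Proof.
by apply/matrixP => i j; rewrite [RHS]mxE !tensor_op_upd mxE mulrA.
Qed.

Definition amp (e : 'cV[C]_#|{: qbasis N}|) x : C := ((prodvec x)^t* *m e) 0 0.

Lemma ampD e x k v w :
  amp e (upd x k (v + w)) = amp e (upd x k v) + amp e (upd x k w).
Proof. by rewrite /amp prodvecD trmxCD mulmxDl mxE. Qed.

Lemma amp_updZ e x k c v : amp e (upd x k (c *: v)) = c^* * amp e (upd x k v).
Proof. by rewrite /amp prodvec_updZ trmxCZ -scalemxAl mxE. Qed.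

Definition basis_family s : 'I_N -> 'cV[C]_2 := fun k => delta_mx (s k) 0.

Lemma prodvec_basis s : prodvec (basis_family s) = delta_mx (enum_rank s) 0.
Proof.
apply/matrixP => i j; rewrite !mxE ord1 eqxx andbT.
have [->|ne] := eqVneq i (enum_rank s).
  by rewrite enum_rankK big1 // => k _; rewrite mxE !eqxx.
have /eqP/ffunP : enum_val i != s.
  by apply: contra_neq ne => <-; rewrite enum_valK.
move=> /existsNP[k /eqP nk].
by rewrite (bigD1 k) //= mxE (negPf nk) mul0r.
Qed.

Lemma amp_basis e i : amp e (basis_family (enum_val i)) = e i 0.
Proof.
rewrite /amp prodvec_basis enum_valK trmx_delta map_delta_mx.
by rewrite -rowE mxE.
Qed.

End ProductVectors.

(** * Slot-additive functions that factor *)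

Section SlotAdditive.
Variables (N : nat) (V : zmodType) (K : fieldType).
Implicit Types (h : ('I_N -> V) -> K) (x : 'I_N -> V).

(** Only additivity is required because [amp e] is conjugate-linear, not linear, in each slot. *)
Definition slot_additive h := forall x k v w,
  h (upd x k (v + w)) = h (upd x k v) + h (upd x k w).

(** A group is not the union of two proper subgroups: if neither [v] nor [w] avoids both kernels,
    [v + w] does. *)
Lemma common_nonzero (phi psi : V -> K) v w :
  {morph phi : a b / a + b} -> {morph psi : a b / a + b} ->
  phi v != 0 -> psi w != 0 -> exists z, phi z != 0 /\ psi z != 0.
Proof.
move=> phiD psiD pv pw.
have [psiv|] := eqVneq (psi v) 0; last by exists v.
have [phiw|] := eqVneq (phi w) 0; last by exists w.
by exists (v + w); rewrite phiD psiD psiv phiw addr0 add0r.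
Qed.

(** The two families are made equal slot by slot, [common_nonzero] supplying each common value. *)
Lemma common_nonzero_family h h' x x' :
  slot_additive h -> slot_additive h' -> h x != 0 -> h' x' != 0 ->
  exists z, h z != 0 /\ h' z != 0.
Proof.
move=> hD h'D hx hx'.
have : forall m : nat, exists z z', [/\ h z != 0, h' z' != 0 &
    forall k : 'I_N, (k < m)%N -> z k = z' k].
  elim=> [|m [z [z' [hz hz' zz']]]]; first by exists x, x'.
  have [mN|Nm] := ltnP m N; last first.
    by exists z, z'; split=> // k _; apply: zz'; apply: leq_trans Nm.
  pose k := Ordinal mN.
  have [w [hw hw']] : exists w, h (upd z k w) != 0 /\ h' (upd z' k w) != 0.
    apply: (@common_nonzero (fun w => h (upd z k w)) (fun w => h' (upd z' k w))
      (z k) (z' k)) => [a b|a b||]; rewrite ?upd_id //.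
  exists (upd z k w), (upd z' k w); split=> // l.
  rewrite /upd ltnS leq_eqVlt -val_eqE /=; case: eqP => //= _; exact: zz'.
move=> /(_ N)[z [z' [hz hz' zz']]]; exists z; split=> //.
by have -> : z = z' by apply/funext => k; exact: zz'.
Qed.

(** Proportionality is transitive when the middle function is not identically zero: [f] and [k] are
    then both multiples of [g]. *)
Lemma parallel_trans (f g k : V -> K) b0 : g b0 != 0 ->
  (forall b b', f b * g b' = f b' * g b) ->
  (forall b b', g b * k b' = g b' * k b) ->
  forall b b', f b * k b' = f b' * k b.
Proof.
move=> g0 fg gk b b'.
have fE c : f c = f b0 / g b0 * g c by rewrite mulrAC -fg mulfK.
have kE c : k c = k b0 / g b0 * g c by rewrite mulrAC (mulrC (k b0)) gk mulrC mulKf.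
by rewrite (fE b) (fE b') (kE b) (kE b'); ring.
Qed.

(** Vanishing of all two-by-two minors in slots [i] and [j]: the two-slot form has rank at most
    one. *)
Definition pair_factors h i j := forall x a a' b b',
  h (upd (upd x i a) j b) * h (upd (upd x i a') j b') =
  h (upd (upd x i a) j b') * h (upd (upd x i a') j b).

(* Any two families at which slot [j] is not degenerate are joined by a path of
   single-slot moves along which slot [j] stays nondegenerate. *)
Lemma slot_factors h j : slot_additive h ->
  (forall i, i != j -> pair_factors h i j) ->
  forall z z' b b',
    h (upd z j b) * h (upd z' j b') = h (upd z j b') * h (upd z' j b).
Proof.
move=> hD hpair.
have : forall (m : nat) z z', (forall k : 'I_N, (m <= k)%N -> z k = z' k) ->
    forall b b', h (upd z j b) * h (upd z' j b') = h (upd z j b') * h (upd z' j b).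
  elim=> [|m IH] z z' zz' b b'.
    by have -> : z = z'; [apply/funext => k; exact: zz' | rewrite mulrC].
  have [mN|Nm] := ltnP m N; last first.
    by apply: IH => k mk; have := leq_trans (ltn_ord k) (leq_trans Nm mk); rewrite ltnn.
  pose k := Ordinal mN.
  have step (y y' : 'I_N -> V) :
      (forall l : 'I_N, (m < l)%N -> y l = y' l) -> y k = y' k ->
      forall c c', h (upd y j c) * h (upd y' j c') = h (upd y j c') * h (upd y' j c).
    move=> yy' yk; apply: IH => l; rewrite leq_eqVlt => /orP[/eqP ml|]; last exact: yy'.
    by have -> : l = k by apply: val_inj.
  have [jk|kj] := eqVneq k j.
    rewrite -(upd_upd z' j (z j) b') -(upd_upd z' j (z j) b); apply: step.
      move=> l ml; rewrite upd_other ?zz' // -jk.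
      by apply/eqP => lk; move: ml; rewrite lk ltnn.
    by rewrite jk upd_same.
  have [z0|/existsNP[c /eqP zc]] := pselect (forall c, h (upd z j c) = 0).
    by rewrite !z0 !mul0r.
  have [z'0|/existsNP[c' /eqP z'c']] := pselect (forall c, h (upd z' j c) = 0).
    by rewrite !z'0 !mulr0.
  have jk : j != k by rewrite eq_sym.
  (* The path goes from [z] to [z'] through their copies with [w] in slot [k]. The outer moves
     change slot [k] only and use [pair_factors]; the middle one joins families that agree from slot
     [m] on and uses the induction hypothesis. *)
  have [w []] : exists w, h (upd (upd z j c) k w) != 0 /\
                          h (upd (upd z' j c') k w) != 0.
    apply: (@common_nonzero (fun w => h (upd (upd z j c) k w))
      (fun w => h (upd (upd z' j c') k w)) (z k) (z' k)) => [a a'|a a'||].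
    - exact: hD.
    - exact: hD.
    - by rewrite updC // upd_id.
    - by rewrite updC // upd_id.
  rewrite !(updC _ _ _ jk) => hw hw'.
  have move_slot (y : 'I_N -> V) d d' : h (upd y j d) * h (upd (upd y k w) j d') =
      h (upd y j d') * h (upd (upd y k w) j d).
    by have := hpair k kj y (y k) w d d'; rewrite upd_id.
  move: b b'; apply: (parallel_trans hw (move_slot z)).
  apply: (@parallel_trans (fun d => h (upd (upd z k w) j d))
    (fun d => h (upd (upd z' k w) j d)) (fun d => h (upd z' j d)) c' hw') => d d';
    last first.
    by rewrite mulrC -move_slot mulrC.
  apply: step; last by rewrite !upd_same.
  move=> l ml; have lk : l != k by apply/eqP => lk; move: ml; rewrite lk ltnn.
  by rewrite !upd_other // zz'.
by move=> /(_ N) H z z'; apply: H => k; rewrite leqNgt ltn_ord.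
Qed.

(** Replacing the slots of [x] by those of [z] one at a time, each replacement multiplies [h] by a
    ratio that [slot_factors] shows to be independent of the other slots. *)
Lemma factorization h x : slot_additive h ->
  (forall i j, i != j -> pair_factors h i j) -> h x != 0 ->
  forall z, h z = h x * \prod_k (h (upd x k (z k)) / h x).
Proof.
move=> hD hpair hx z.
pose y m : 'I_N -> V := fun k => if (k < m)%N then z k else x k.
have : forall m, (m <= N)%N ->
    h (y m) = h x * \prod_(k < N | (k < m)%N) (h (upd x k (z k)) / h x).
  elim=> [|m IH] mN.
    by rewrite big_pred0 ?mulr1 //; congr h; apply/funext.
  pose k := Ordinal mN.
  have yE : y m.+1 = upd (y m) k (z k).
    apply/funext => l; rewrite /y /upd ltnS leq_eqVlt -val_eqE /=.
    by case: eqP => //= lm; congr z; exact: val_inj.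
  have ymk : y m k = x k by rewrite /y /= ltnn.
  have ymE : y m = upd (y m) k (x k) by rewrite -ymk upd_id.
  rewrite (bigD1 k) //= (eq_bigl (fun l : 'I_N => (l < m)%N)); last first.
    move=> l; rewrite ltnS leq_eqVlt -val_eqE /=.
    by case: eqP => [->|]; rewrite ?ltnn ?andbT // andbF.
  rewrite mulrCA -(IH (ltnW mN)) mulrAC; apply/(mulIf hx); rewrite divfK //.
  have := @slot_factors h k hD (fun i ik => hpair i k ik) (y m) x (z k) (x k).
  by rewrite -yE upd_id -ymE mulrC => ->; rewrite mulrC.
move=> /(_ N (leqnn N)); rewrite /y.
have -> : (fun k : 'I_N => if (k < N)%N then z k else x k) = z.
  by apply/funext => k; rewrite ltn_ord.
by move=> ->; congr (_ * _); apply: eq_bigl => k; rewrite ltn_ord.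
Qed.

End SlotAdditive.

(** * Entanglement of pure states *)

Lemma sum_ord2 (V : nmodType) (F : 'I_2 -> V) : \sum_i F i = F 0 + F 1.
Proof.
by rewrite big_ord_recl big_ord1; congr (_ + F _); exact: val_inj.
Qed.

Lemma ord2P (a : 'I_2) : a = 0 \/ a = 1.
Proof. by case: a => [[|[|//]] i]; [left|right]; exact: val_inj. Qed.

Lemma det_mx22 (K : comPzRingType) (A : 'M[K]_2) :
  \det A = A 0 0 * A 1 1 - A 0 1 * A 1 0.
Proof.
rewrite (expand_det_row _ 0) sum_ord2 /cofactor !det_mx11 !mxE /= expr0 expr1.
have -> : lift 0 0 = 1 :> 'I_2 by exact: val_inj.
have -> : lift 1 0 = 0 :> 'I_2 by exact: val_inj.
by rewrite mul1r mulN1r mulrN.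
Qed.

Definition orthonormal_family (C : numClosedFieldType) n m (u : 'I_m -> 'cV[C]_n) :=
  forall a b, ((u a)^t* *m u b) 0 0 = (a == b)%:R.

(** Singular value decomposition from the spectral theorem for [M^t* *m M]. The second argument of
    the form is conjugated to match amplitudes, which are conjugate-linear in both slots; hence the
    right vectors are the columns of [U^T]. *)
Lemma singular_vectors (C : numClosedFieldType) n (M : 'M[C]_n) : \det M != 0 ->
  exists s r : 'I_n -> 'cV[C]_n, [/\ orthonormal_family s, orthonormal_family r &
    forall a b, (((s a)^t* *m M *m map_mx Num.conj (r b)) 0 0 == 0) = (a != b)].
Proof.
move=> dM; set H := M^t* *m M.
have hH : H \is hermsymmx by rewrite hermsymE trmxCM trmxCK.
set U := spectralmx H; set D := diag_mx (spectral_diag H).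
have uU : U *m U^t* = 1%:M by apply/unitarymxP; exact: spectral_unitarymx.
have HE : H = U^t* *m D *m U.
  rewrite -(invmx_unitary (spectral_unitarymx H)).
  by apply/orthomx_spectralP; exact: hermitian_normalmx.
pose W := M *m U^t*.
have WW : W^t* *m W = D.
  rewrite trmxCM trmxCK mulmxA -(mulmxA U) -/H HE !mulmxA uU mul1mx.
  by rewrite -mulmxA uU mulmx1.
have WWE a b : ((col a W)^t* *m col b W) 0 0 = (W^t* *m W) a b.
  by rewrite !mxE; apply: eq_bigr => i _; rewrite !mxE.
pose d a := D a a.
have d_neq0 a : d a != 0.
  rewrite /d -WW -WWE dot_eq0; apply/eqP => W0.
  have Wu : W \in unitmx.
    rewrite unitmx_mul unitmxE unitfE dM /= unitarymx_unit //.
    by rewrite trmxC_unitary spectral_unitarymx.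
  have /matrixP/(_ a 0) : invmx W *m col a W = 0 by rewrite W0 mulmx0.
  by rewrite colE mulmxA mulVmx // mul1mx !mxE !eqxx => /eqP; rewrite oner_eq0.
have d_ge0 a : 0 <= d a by rewrite /d -WW -WWE dot_ge0.
have DE a b : D a b = d a *+ (a == b) by rewrite /d /D !mxE eqxx mulr1n.
have sq a : ((sqrtC (d a))^-1)^* = (sqrtC (d a))^-1.
  by rewrite conj_Creal // ger0_real // invr_ge0 sqrtC_ge0.
have sqN0 a : sqrtC (d a) != 0 by rewrite sqrtC_eq0.
exists (fun a => (sqrtC (d a))^-1 *: col a W), (fun a => col a U^T); split.
- move=> a b; rewrite trmxCZ -scalemxAl -scalemxAr !scale11 WWE WW DE.
  rewrite sq; have [<-|] := eqVneq a b; last by rewrite mulr0n !mulr0.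
  by rewrite mulr1n mulrA -invfM -expr2 sqrtCK mulVf.
- move=> a b; transitivity ((U *m U^t*) b a); last by rewrite uU mxE eq_sym.
  by rewrite dotE mxE; apply: eq_bigr => i _; rewrite !mxE mulrC.
- move=> a b.
  have -> : map_mx Num.conj (col b U^T) = U^t* *m delta_mx b 0.
    by rewrite -colE; apply/matrixP => i j; rewrite !mxE.
  rewrite trmxCZ sq -!scalemxAl scale11 -mulmxA (mulmxA M) -/W -colE WWE WW DE.
  rewrite mulf_eq0 invr_eq0 (negPf (sqN0 a)) /=.
  by case: (a == b) => /=; rewrite ?mulr0n ?eqxx // mulr1n (negPf (d_neq0 a)).
Qed.

(** The minor of the form is [\det M] times the conjugated determinants of the pairs [a], [a'] and
    [b], [b']. *)
Lemma singular_form_factors (C : numClosedFieldType) (M : 'M[C]_2)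
    (a a' b b' : 'cV[C]_2) :
  let B (x y : 'cV[C]_2) := (x^t* *m M *m map_mx Num.conj y) 0 0 in
  \det M = 0 -> B a b * B a' b' = B a b' * B a' b.
Proof.
move=> B; rewrite det_mx22 => dM; rewrite /B !mxE !sum_ord2 !mxE !sum_ord2 !mxE.
apply/eqP; rewrite -subr_eq0.
set p := (a 0 0)^*; set q := (a 1 0)^*; set p' := (a' 0 0)^*; set q' := (a' 1 0)^*.
set r := (b 0 0)^*; set t := (b 1 0)^*; set r' := (b' 0 0)^*; set t' := (b' 1 0)^*.
have key z : z = (M 0 0 * M 1 1 - M 0 1 * M 1 0) * (p * q' - q * p') *
    (r * t' - t * r') -> z == 0.
  by move=> ->; rewrite dM !mul0r.
by apply: key; ring.
Qed.

Section Entanglement.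
Variables (R : realType) (N : nat).
Local Notation C := (complex R).
Implicit Types (e : 'cV[C]_#|{: qbasis N}|) (x : 'I_N -> 'cV[C]_2).

Lemma cV2E (v : 'cV[C]_2) : v = v 0 0 *: delta_mx 0 0 + v 1 0 *: delta_mx 1 0.
Proof.
apply/matrixP => i j; rewrite ord1 !mxE.
by case: (ord2P i) => ->; rewrite /= ?mulr1 ?mulr0 ?addr0 ?add0r.
Qed.

Lemma amp_slot e x k v :
  amp e (upd x k v) = \sum_(p < 2) (v p 0)^* * amp e (upd x k (delta_mx p 0)).
Proof. by rewrite {1}(cV2E v) ampD !amp_updZ sum_ord2. Qed.

Definition amp_mx e x i j : 'M[C]_2 :=
  \matrix_(p < 2, q < 2) amp e (upd (upd x i (delta_mx p 0)) j (delta_mx q 0)).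

Lemma amp_mxE e x i j u v : i != j ->
  amp e (upd (upd x i u) j v) = (u^t* *m amp_mx e x i j *m map_mx Num.conj v) 0 0.
Proof.
move=> ij; rewrite amp_slot -mulmxA mxE.
under eq_bigr => q _ do rewrite updC // amp_slot mulr_sumr.
rewrite exchange_big /=; apply: eq_bigr => p _.
rewrite !mxE mulr_sumr; apply: eq_bigr => q _.
by rewrite !mxE updC 1?eq_sym // mulrCA (mulrC (_ (v q 0))).
Qed.

(** If all pairs of slots factored, [factorization] would make [e] a product vector. So some
    two-qubit amplitude matrix is invertible, and its singular vectors diagonalize it. *)
Lemma entangled_singular_vectors e : e != 0 ->
  (forall c y, e != c *: prodvec y) ->
  exists (i j : 'I_N) x (s r : 'I_2 -> 'cV[C]_2),
    [/\ i != j, orthonormal_family s, orthonormal_family r &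
    forall a b, (amp e (upd (upd x i (s a)) j (r b)) == 0) = (a != b)].
Proof.
move=> e0 ent.
have hD : slot_additive (amp e) by move=> x k v w; exact: ampD.
have [pair|/existsNP[i /existsNP[j /not_implyP[ij npair]]]] :=
    pselect (forall i j, i != j -> pair_factors (amp e) i j).
  have [i ei] : exists i, e i 0 != 0.
    apply/existsP; apply: contraNT e0 => /existsPn e0.
    apply/eqP/matrixP => i j; rewrite ord1 [RHS]mxE; apply/eqP.
    by have := e0 i; rewrite negbK.
  (* Factorizing around a basis string where [e] is nonzero exhibits [e] as a multiple of a product
     vector whose entries are amplitude ratios. *)
  set w := basis_family R (enum_val i : qbasis N).
  have hw : amp e w != 0 by rewrite amp_basis.
  have := ent (amp e w) (fun k => \col_b (amp e (upd w k (delta_mx b 0)) / amp e w)).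
  case/eqP; apply/matrixP => l l'.
  rewrite ord1 -amp_basis (factorization hD pair hw) !mxE; congr (_ * _).
  by apply: eq_bigr => k _; rewrite mxE.
have [x nx] : exists x, \det (amp_mx e x i j) != 0.
  apply/not_existsP => H; apply: npair => x a a' b b'.
  rewrite !(amp_mxE _ _ _ _ ij); apply: singular_form_factors.
  by have /negP/negPn/eqP := H x.
have [s [r [os or sr]]] := singular_vectors nx.
by exists i, j, x, s, r; split=> // a b; rewrite amp_mxE.
Qed.

End Entanglement.

(** * The Clauser-Horne inequality *)

Section ClassicalBound.
Variables (R : realType) (N : nat) (i j : 'I_N).

Definition on_pair (T : Type) (x : 'I_N -> T) (u v : T) : 'I_N -> T :=
  upd (upd x i u) j v.

Lemma on_pair_l T (x : 'I_N -> T) u v : i != j -> on_pair x u v i = u.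
Proof. by move=> ij; rewrite /on_pair upd_other // upd_same. Qed.

Lemma on_pair_r T (x : 'I_N -> T) u v : on_pair x u v j = v.
Proof. exact: upd_same. Qed.

Lemma on_pair_out T (x : 'I_N -> T) u v k : k != i -> k != j ->
  on_pair x u v k = x k.
Proof. by move=> ki kj; rewrite /on_pair !upd_other. Qed.

(** Used both for settings and for outcomes: the observers other than [i] and [j] stay at setting 0
    and outcome 0. *)
Definition pairf (a b : 'I_2) := on_pair (fun=> 0 : 'I_2) a b.

Lemma integrable_prod01 d (T : measurableType d) (mu : probability T R)
    (g : 'I_N -> T -> R) :
  (forall k, measurable_fun setT (g k)) -> (forall k l, 0 <= g k l <= 1) ->
  mu.-integrable setT (EFin \o (fun l => \prod_k g k l)).
Proof.
move=> mg g01; apply: measurable_bounded_integrable => //.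
- by apply: le_lt_trans (probability_le1 mu measurableT) _; rewrite ltry.
- exact: measurable_prod.
exists 1; split; first exact: num_real.
move=> x x1 l _ /=; rewrite ger0_norm; last first.
  by apply: prodr_ge0 => k _; case/andP: (g01 k l).
by apply: le_trans (ltW x1); apply: prodr_ile1 => k _; exact: g01.
Qed.

(* The inequality is conditioned on outcome 0 of all the observers other than
   [i] and [j]; marginals are written as sums of joint probabilities. *)
Lemma lhv_clauser_horne (p : ('I_N -> 'I_2) -> ('I_N -> 'I_2) -> complex R) :
  i != j -> @has_lhv_model R N (fun=> 2%N) p ->
  p (pairf 0 1) (pairf 0 0) + p (pairf 1 0) (pairf 0 0) <=
  p (pairf 1 1) (pairf 0 0) + p (pairf 0 0) (pairf 0 0)
    + (p (pairf 0 0) (pairf 0 1) + p (pairf 0 0) (pairf 1 0)).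
Proof.
move=> ij [d [T [mu [q [mq q0 q1 pE]]]]].
pose f c o l : R := \prod_(k < N) q k (c k) (o k) l.
have q01 k t a l : 0 <= q k t a l <= 1.
  rewrite q0 /= -(q1 k t l) sum_ord2.
  by case: (ord2P a) => ->; rewrite ?lerDl ?lerDr q0.
have fi c o : mu.-integrable setT (EFin \o f c o).
  by apply: integrable_prod01 => k; [exact: mq | move=> l; exact: q01].
have {}pE c o : p c o = ((\int[mu]_l f c o l)%:C)%C by exact: pE.
rewrite !pE -!rmorphD lecR.
have addi g h : mu.-integrable setT (EFin \o g) -> mu.-integrable setT (EFin \o h) ->
    mu.-integrable setT (EFin \o (fun l => g l + h l)).
  by move=> gi hi; exact: (integrableD measurableT gi hi).
have fiD c o c' o' := addi _ _ (fi c o) (fi c' o').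
rewrite -!RintegralD //; try exact: fi; try exact: fiD.
apply: le_Rintegral => //; first by apply: addi; exact: fiD.
(* For a fixed hidden variable every term has the common nonnegative factor [w], leaving a two-party
   inequality. *)
move=> l _; pose w := \prod_(k < N | (k != i) && (k != j)) q k 0 0 l.
have fE t t' a a' : f (pairf t t') (pairf a a') l = q i t a l * q j t' a' l * w.
  rewrite /f /pairf (bigD1 i) //= (bigD1 j) /=; last by rewrite eq_sym.
  rewrite !on_pair_l // !on_pair_r mulrA; congr (_ * _).
  by apply: eq_bigr => k /andP[ki kj]; rewrite !on_pair_out.
have w0 : 0 <= w by apply: prodr_ge0 => k _; exact: q0.
rewrite !fE -!mulrDl; apply: ler_wpM2r => //.
have := q1 i 0 l; have := q1 j 0 l; rewrite !sum_ord2.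
have := q01 i 0 0 l; have := q01 i 1 0 l; have := q01 j 0 0 l; have := q01 j 1 0 l.
set x0 := q i 0 0 l; set x1 := q i 1 0 l; set y0 := q j 0 0 l; set y1 := q j 1 0 l.
move=> /andP[y10 y11] /andP[y00 y01] /andP[x10 x11] /andP[x00 x01] hy hx.
have -> : q j 0 1 l = 1 - y0 by rewrite -hy; ring.
have -> : q i 0 1 l = 1 - x0 by rewrite -hx; ring.
rewrite -subr_ge0.
(* The Clauser-Horne polynomial as a convex combination, with weights [x1] and [1 - x1], of two sums
   of products of probabilities. *)
have -> : x1 * y1 + x0 * y0 + (x0 * (1 - y0) + (1 - x0) * y0) - (x0 * y1 + x1 * y0) =
    x1 * (y1 * (1 - x0) + x0 * (1 - y0)) + (1 - x1) * (y0 * (1 - x0) + x0 * (1 - y1)).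
  by ring.
by apply: addr_ge0; apply: mulr_ge0; rewrite ?subr_ge0 //; apply: addr_ge0;
  apply: mulr_ge0; rewrite ?subr_ge0.
Qed.

End ClassicalBound.

(** * Measurements of a qubit *)

Section Measurements.
Variable C : numClosedFieldType.
Implicit Types (u v : 'cV[C]_2) (s : 'I_2 -> 'cV[C]_2).

Definition sqnorm n (v : 'cV[C]_n) : C := (v^t* *m v) 0 0.

Definition ray v : 'M[C]_2 := (sqnorm v)^-1 *: (v *m v^t*).

Definition ray_test v (a : 'I_2) : 'M[C]_2 :=
  if a == 0 then ray v else 1%:M - ray v.

Lemma ray_test_sum v : ray_test v 0 + ray_test v 1 = 1%:M.
Proof. by rewrite /ray_test /= addrC subrK. Qed.

Definition perp v : 'cV[C]_2 :=
  \col_i (if i == 0 then - (v 1 0)^* else (v 0 0)^*).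

Lemma sqnorm2 v : sqnorm v = (v 0 0)^* * v 0 0 + (v 1 0)^* * v 1 0.
Proof. by rewrite /sqnorm dotE sum_ord2. Qed.

Lemma conjCN (a : C) : (- a)^* = - a^*.
Proof. exact: rmorphN. Qed.

Lemma conjCM (a b : C) : (a * b)^* = a^* * b^*.
Proof. exact: rmorphM. Qed.

Lemma perp_complement v :
  v *m v^t* + perp v *m (perp v)^t* = (sqnorm v)%:M.
Proof.
apply/matrixP => i j; rewrite sqnorm2 !mxE !big_ord1 !mxE.
case: (ord2P i) => ->; case: (ord2P j) => -> /=;
  rewrite ?conjCN ?conjCK ?mulr1n ?mulr0n; ring.
Qed.

Lemma perp_sqnorm v : sqnorm (perp v) = sqnorm v.
Proof. by rewrite !sqnorm2 !mxE /= conjCN !conjCK; ring. Qed.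

Lemma perp_orth v : (v^t* *m perp v) 0 0 = 0.
Proof. by rewrite dotE sum_ord2 !mxE /=; ring. Qed.

Definition lin2 s (a b : C) := a *: s 0 + b *: s 1.

Lemma lin2_sqnorm s a b : orthonormal_family s ->
  sqnorm (lin2 s a b) = a^* * a + b^* * b.
Proof.
move=> os; rewrite /sqnorm /lin2 trmxCD !trmxCZ !mulmxDl !mulmxDr.
rewrite -!scalemxAl -!scalemxAr !(add11, scale11) !os /=.
by ring.
Qed.

(** For the square matrix [U] with columns [s a], [U^t* *m U = 1] implies [U *m U^t* = 1]. *)
Lemma orthonormal_complete s : orthonormal_family s ->
  s 0 *m (s 0)^t* + s 1 *m (s 1)^t* = 1%:M.
Proof.
move=> os; pose U := \matrix_(i, a) s a i 0.
have U1 : U^t* *m U = 1%:M.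
  apply/matrixP => a b; rewrite [RHS]mxE -os dotE mxE.
  by apply: eq_bigr => i _; rewrite !mxE.
rewrite -(mulmx1C U1); apply/matrixP => i j.
by rewrite !mxE !big_ord1 sum_ord2 !mxE.
Qed.

End Measurements.

(** By [perp_complement], [1%:M - ray v] is the projector on [perp v]; dividing [v] and [perp v] by
    their common norm gives the measurement basis. *)
Lemma ray_test_projective (R : realType) (v : 'cV[complex R]_2) : v != 0 ->
  projective_measurement (ray_test v).
Proof.
move=> v0; set n := sqnorm v.
have n0 : n != 0 by rewrite /n /sqnorm dot_eq0.
have nge : 0 <= n by exact: dot_ge0.
set c := (sqrtC n)^-1.
have cr : c^* = c by rewrite conj_Creal // ger0_real // invr_ge0 sqrtC_ge0.
have cc : c * c = n^-1 by rewrite -invfM -expr2 sqrtCK.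
pose w (a : 'I_2) := if a == 0 then v else perp v.
exists (fun a => c *: w a); split=> [a b|a].
  rewrite trmxCZ cr -scalemxAl -scalemxAr scalerA cc.
  apply/matrixP => x y; rewrite !ord1 mxE [RHS]mxE eqxx mulr1n.
  have -> : ((w a)^t* *m w b) 0 0 = n *+ (a == b).
    rewrite /w; case: (ord2P a) => ->; case: (ord2P b) => -> /=.
    - by [].
    - exact: perp_orth.
    - by rewrite dot_conj perp_orth rmorph0.
    - exact: perp_sqnorm.
  by case: (a == b); rewrite ?mulr0n ?mulr0 // mulr1n mulVf.
rewrite trmxCZ cr -scalemxAl -scalemxAr scalerA cc /ray_test /ray /w.
case: (a == 0) => //; rewrite -/n.
have /(congr1 (fun M => n^-1 *: M)) := perp_complement v.
by rewrite scalerDr -/n scale_scalar_mx mulVf // => <-; rewrite addrC addKr.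
Qed.

(** * Quantum violation of the Clauser-Horne inequality *)

Lemma quad_expand (C : numClosedFieldType) n (A : 'M[C]_n) (u v : 'cV[C]_n) a b :
  ((a *: u + b *: v)^t* *m A *m (a *: u + b *: v)) 0 0 =
  a^* * a * (u^t* *m A *m u) 0 0 + b^* * b * (v^t* *m A *m v) 0 0
  + (b^* * a * (v^t* *m A *m u) 0 0 + a^* * b * (u^t* *m A *m v) 0 0).
Proof.
rewrite trmxCD !trmxCZ !mulmxDl !mulmxDr -!scalemxAl -!scalemxAr.
by rewrite !(add11, scale11); ring.
Qed.

(** By [psd_ker_col] the isotropic vectors [k] and [k'] lie in the kernel of [A], so their cross
    terms vanish as well. *)
Lemma psd_quad_expand (C : numClosedFieldType) n (A : 'M[C]_n)
    (u v k k' : 'cV[C]_n) a b c c' :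
  A^t* = A -> (forall x : 'cV[C]_n, 0 <= (x^t* *m A *m x) 0 0) ->
  (k^t* *m A *m k) 0 0 = 0 -> (k'^t* *m A *m k') 0 0 = 0 ->
  let y := a *: u + b *: v + (c *: k + c' *: k') in
  (y^t* *m A *m y) 0 0 =
  a^* * a * (u^t* *m A *m u) 0 0 + b^* * b * (v^t* *m A *m v) 0 0
  + (b^* * a * (v^t* *m A *m u) 0 0 + a^* * b * (u^t* *m A *m v) 0 0).
Proof.
move=> hA pA k0 k'0 y; rewrite -quad_expand; pose z := a *: u + b *: v.
have yz : A *m y = A *m z.
  rewrite mulmxDr [X in _ + X]mulmxDr -!scalemxAr.
  rewrite (psd_ker_col hA pA k0) (psd_ker_col hA pA k'0).
  by rewrite !scaler0 !addr0.
by rewrite -mulmxA yz mulmxA -{1}hA -trmxCM yz trmxCM hA.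
Qed.

(** The right side minus the left side equals [- (k * e * (1 + k) / D)]. Here [k] sets the tilt of
    the vectors of the second observer, [e] is the squared modulus of the coherence and [D] the
    squared norm of the tilted vectors. *)
Lemma weak_coherence_violation (C : numClosedFieldType) (p q e k D : C)
    (j01 j10 j11 j00 k01 k10 : C) :
  0 < e -> 0 < k -> 0 < D -> D = 1 + k ^+ 2 * e -> k * (p + q) = 1 - k ->
  j01 = D^-1 * p -> j00 = D^-1 * p ->
  j10 = 2^-1 * D^-1 * (p + q * (k ^+ 2 * e) + 2 * (k * e)) ->
  j11 = 2^-1 * D^-1 * (p + q * (k ^+ 2 * e) - 2 * (k * e)) ->
  k01 = p - j00 -> k10 = D^-1 * (p + q * (k ^+ 2 * e)) - j00 ->
  ~ (j01 + j10 <= j11 + j00 + (k01 + k10)).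
Proof.
move=> e0 k0 D0 DE kpq -> -> -> -> -> ->; rewrite -subr_ge0.
have DN0 : D != 0 by rewrite gt_eqF.
have pos : 0 < k * e * (2 - k * (p + q)) / D.
  have -> : 2 - k * (p + q) = 1 + k by rewrite kpq; ring.
  by rewrite divr_gt0 // mulr_gt0 ?addr_gt0 // mulr_gt0.
set z := (X in 0 <= X); have -> : z = - (k * e * (2 - k * (p + q)) / D).
  by rewrite /z; subst D; field.
by rewrite oppr_ge0 (lt_geF pos).
Qed.

Section ClauserHorne.
Variables (R : realType) (N : nat) (rho : qop R N) (i j : 'I_N).
Local Notation C := (complex R).
Variables (w : 'I_N -> 'cV[C]_2) (s r : 'I_2 -> 'cV[C]_2).
Hypotheses (rho_psd : psd rho) (ij : i != j).
Hypotheses (os : orthonormal_family s) (or : orthonormal_family r).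

Definition pair_vec a b := prodvec (on_pair i j w (s a) (r b)).
Definition rho_form (u v : 'cV[C]_#|{: qbasis N}|) := (u^t* *m rho *m v) 0 0.
Definition pair_tr (A B : 'M[C]_2) : C :=
  \tr (tensor_op (on_pair i j (fun k => ray (w k)) A B) *m rho).
(** The normalization of the projectors [ray (w k)] of the other observers, split off when they are
    written as dyads of [w k]. *)
Definition pair_weight : C := \prod_k on_pair i j (fun k => (sqnorm (w k))^-1) 1 1 k.
Definition dyad_tr (u v : 'cV[C]_2) := pair_tr (u *m u^t*) (v *m v^t*).

Lemma pair_dyad u v : dyad_tr u v =
  pair_weight * rho_form (prodvec (on_pair i j w u v)) (prodvec (on_pair i j w u v)).
Proof.
rewrite /dyad_tr /pair_tr; set Y := on_pair i j w u v.
have -> : on_pair i j (fun k => ray (w k)) (u *m u^t*) (v *m v^t*) =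
    (fun k => on_pair i j (fun k => (sqnorm (w k))^-1) 1 1 k *: (Y k *m (Y k)^t*)).
  apply/funext => k; rewrite /Y /on_pair /upd.
  by case: (k == j); [rewrite scale1r | case: (k == i); rewrite // scale1r].
rewrite tensor_opZ -prodvec_adj -scalemxAl mxtraceZ -/pair_weight; congr (_ * _).
by rewrite -mulmxA mxtrace_mulC /rho_form trace_mx11.
Qed.

Lemma pair_addl A A' B : pair_tr (A + A') B = pair_tr A B + pair_tr A' B.
Proof.
rewrite /pair_tr /on_pair !(updC _ _ _ ij) tensor_opD mulmxDl.
exact: mxtraceD.
Qed.

Lemma pair_addr A B B' : pair_tr A (B + B') = pair_tr A B + pair_tr A B'.
Proof. by rewrite /pair_tr /on_pair tensor_opD mulmxDl mxtraceD. Qed.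

Lemma pair_scalel a A B : pair_tr (a *: A) B = a * pair_tr A B.
Proof.
rewrite /pair_tr /on_pair !(updC _ _ _ ij) tensor_op_updZ -scalemxAl.
exact: mxtraceZ.
Qed.

Lemma pair_scaler a A B : pair_tr A (a *: B) = a * pair_tr A B.
Proof. by rewrite /pair_tr /on_pair tensor_op_updZ -scalemxAl mxtraceZ. Qed.

Hypotheses (X01 : rho_form (pair_vec 0 1) (pair_vec 0 1) = 0)
  (X10 : rho_form (pair_vec 1 0) (pair_vec 1 0) = 0).
Hypothesis X0011 : rho_form (pair_vec 0 0) (pair_vec 1 1) != 0.

Lemma rho_adj : rho^t* = rho.
Proof. by case: rho_psd => h _; apply/eqP; rewrite -hermsymE. Qed.

Lemma rho_form_conj u v : rho_form u v = (rho_form v u)^*.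
Proof. by rewrite /rho_form -trmxCE !trmxCM trmxCK rho_adj mulmxA. Qed.

Lemma local_vectors_neq0 k : k != i -> k != j -> w k != 0.
Proof.
move=> ki kj; apply: contraNneq X0011 => wk.
have -> : pair_vec 0 0 = 0; last by rewrite /rho_form trmxC0 !mul0mx mxE.
apply/matrixP => a b; rewrite !mxE (bigD1 k) //= on_pair_out // wk mxE.
by rewrite mul0r.
Qed.

Lemma pair_weight_gt0 : 0 < pair_weight.
Proof.
apply: prodr_gt0 => k _; rewrite /on_pair /upd.
have [//|kj] := boolP (k == j); have [//|ki] := boolP (k == i).
rewrite invr_gt0 lt_neqAle dot_ge0 andbT eq_sym /sqnorm dot_eq0.
exact: local_vectors_neq0.
Qed.

(** The unnormalized conditional state of qubits [i] and [j] has populations [p] and [q] on 00 and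
    11 and coherence [d] between them, in the bases [s] and [r]. *)
Definition expansion (p q d : C) := forall a0 a1 b0 b1,
  dyad_tr (lin2 s a0 a1) (lin2 r b0 b1) =
  p * ((a0 * b0)^* * (a0 * b0)) + q * ((a1 * b1)^* * (a1 * b1))
  + (d * ((a1 * b1)^* * (a0 * b0)) + d^* * ((a0 * b0)^* * (a1 * b1))).

(** By [X01], [X10] and positivity, the 01 and 10 components of a product vector lie in the kernel
    of [rho]; only 00 and 11 contribute. *)
Lemma pair_expand : expansion
  (pair_weight * rho_form (pair_vec 0 0) (pair_vec 0 0))
  (pair_weight * rho_form (pair_vec 1 1) (pair_vec 1 1))
  (pair_weight * rho_form (pair_vec 1 1) (pair_vec 0 0)).
Proof.
move=> a0 a1 b0 b1.
rewrite pair_dyad; set Y := prodvec _.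
have YE : Y = (a0 * b0) *: pair_vec 0 0 + (a1 * b1) *: pair_vec 1 1
    + ((a0 * b1) *: pair_vec 0 1 + (a1 * b0) *: pair_vec 1 0).
  rewrite /Y /pair_vec /on_pair prodvecD !prodvec_updZ !(updC _ _ _ ij) !prodvecD !prodvec_updZ.
  rewrite !scalerDr !scalerA !(mulrC b0) !(mulrC b1).
  have E4 (V : zmodType) (x y z t : V) : x + y + (z + t) = x + t + (z + y).
    by rewrite [z + t]addrC addrACA [y + z]addrC.
  exact: E4.
have -> : rho_form Y Y = (a0 * b0)^* * (a0 * b0) * rho_form (pair_vec 0 0) (pair_vec 0 0)
   + (a1 * b1)^* * (a1 * b1) * rho_form (pair_vec 1 1) (pair_vec 1 1)
   + ((a1 * b1)^* * (a0 * b0) * rho_form (pair_vec 1 1) (pair_vec 0 0)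
      + (a0 * b0)^* * (a1 * b1) * rho_form (pair_vec 0 0) (pair_vec 1 1)).
  rewrite YE; apply: psd_quad_expand => //; first exact: rho_adj.
  by case: rho_psd.
rewrite (conjCM pair_weight) -rho_form_conj (conj_Creal (gtr0_real pair_weight_gt0)).
generalize pair_weight, (rho_form (pair_vec 0 0) (pair_vec 0 0)),
  (rho_form (pair_vec 1 1) (pair_vec 1 1)), (rho_form (pair_vec 1 1) (pair_vec 0 0)),
  (rho_form (pair_vec 0 0) (pair_vec 1 1)).
by move=> g x y z t; ring.
Qed.

Lemma pair_ray u v :
  pair_tr (ray u) (ray v) = (sqnorm u)^-1 * (sqnorm v)^-1 * dyad_tr u v.
Proof. by rewrite pair_scalel pair_scaler mulrA. Qed.

Lemma pair_ray_l u :
  pair_tr (ray u) 1%:M = (sqnorm u)^-1 * (dyad_tr u (r 0) + dyad_tr u (r 1)).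
Proof. by rewrite -(orthonormal_complete or) pair_addr !pair_scalel mulrDr. Qed.

Lemma pair_ray_r v :
  pair_tr 1%:M (ray v) = (sqnorm v)^-1 * (dyad_tr (s 0) v + dyad_tr (s 1) v).
Proof. by rewrite -(orthonormal_complete os) pair_addl !pair_scaler mulrDr. Qed.

Lemma lin2_0 t : t 0 = lin2 t 1 0 :> 'cV[C]_2.
Proof. by rewrite /lin2 scale1r scale0r addr0. Qed.

Lemma lin2_1 t : t 1 = lin2 t 0 1 :> 'cV[C]_2.
Proof. by rewrite /lin2 scale1r scale0r add0r. Qed.

(* Observer [i] tests s_0 and s_0 + s_1, observer [j] tests r_0 +- tau r_1; the
   Clauser-Horne expression is first order in tau through the coherence [d],
   but only second order through the populations [p] and [q]. *)
Lemma expansion_violation p q d : expansion p q d ->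
  0 <= p -> 0 <= q -> d != 0 -> violates_local_realism rho.
Proof.
move=> pair_expand p0 q0 d0.
have pq1 : 0 < p + q + 1 by rewrite ltr_wpDl // addr_ge0.
(* This size gives [kappa * (p + q) = 1 - kappa], so the first-order gain beats the second-order
   loss. The phase of [tau] is that of [d], which makes the coherence term [kappa * (d^* * d)]
   positive. *)
pose kappa := (p + q + 1)^-1.
have kr : kappa^* = kappa by rewrite conj_Creal // gtr0_real // invr_gt0.
pose tau := kappa * d.
have tc : tau^* = kappa * d^* by rewrite /tau conjCM kr.
pose A (t : 'I_2) := lin2 s 1 (t == 1)%:R.
pose B (t : 'I_2) := lin2 r 1 (if t == 0 then tau else - tau).
(* Away from [i] and [j] both settings are the same test of [w k]. *)
pose P (k : 'I_N) (t a : 'I_2) := ray_test (on_pair i j w (A t) (B t) k) a.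
have sA t : sqnorm (A t) = 1 + (t == 1)%:R.
  by rewrite lin2_sqnorm // conjC1 mul1r conjC_nat -natrM; case: (t == 1).
have sB t : sqnorm (B t) = 1 + kappa ^+ 2 * (d^* * d).
  rewrite lin2_sqnorm // conjC1 mul1r; case: (t == 0); rewrite ?conjCN tc /tau; ring.
have m0 : 0 < d^* * d by rewrite mulrC mul_conjC_gt0.
have D0 : 0 < 1 + kappa ^+ 2 * (d^* * d).
  by rewrite ltr_wpDr // mulr_ge0 ?exprn_ge0 ?ltW // invr_gt0.
exists (fun=> 2%N), P; split.
  move=> k t; left; apply: ray_test_projective.
  rewrite /on_pair /upd; have [_|kj] := boolP (k == j).
    by rewrite -dot_eq0 -/(sqnorm _) sB gt_eqF.
  have [_|ki] := boolP (k == i); last exact: local_vectors_neq0.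
  by rewrite -dot_eq0 -/(sqnorm _) sA gt_eqF // ltr_pwDl.
move=> /(lhv_clauser_horne ij).
have JE t t' a a' : joint_prob rho P (pairf i j t t') (pairf i j a a') =
    pair_tr (ray_test (A t) a) (ray_test (B t') a').
  rewrite /joint_prob /pair_tr; congr (\tr (tensor_op _ *m rho)); apply/funext => k.
  rewrite /P /pairf /on_pair /upd.
  by case: (k == j) => //; case: (k == i).
rewrite !JE {JE}; set D := 1 + kappa ^+ 2 * (d^* * d) in D0 sB *.
pose e := d^* * d.
have DN0 : D != 0 by rewrite gt_eqF.
have J t t' : pair_tr (ray_test (A t) 0) (ray_test (B t') 0) =
    (sqnorm (A t))^-1 * (sqnorm (B t'))^-1 * dyad_tr (A t) (B t') by exact: pair_ray.
have GA t' : dyad_tr (A 0) (B t') = p.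
  by rewrite pair_expand /= !(mul0r, mulr0, addr0, mulr1, mul1r, conjC1, conjC0).
have GB0 : dyad_tr (A 1) (B 0) = p + q * (kappa ^+ 2 * e) + 2 * (kappa * e).
  rewrite pair_expand /= !(mul0r, mulr0, addr0, mulr1, mul1r, conjC1, conjC0) tc /tau /e.
  by ring.
have GB1 : dyad_tr (A 1) (B 1) = p + q * (kappa ^+ 2 * e) - 2 * (kappa * e).
  rewrite pair_expand /= !(mul0r, mulr0, addr0, mulr1, mul1r, conjC1, conjC0) conjCN tc /tau /e.
  by ring.
have GA0 : dyad_tr (A 0) (r 0) = p.
  rewrite (lin2_0 r) pair_expand /=.
  by rewrite !(mul0r, mulr0, addr0, mulr1, mul1r, conjC1, conjC0).
have GA1 : dyad_tr (A 0) (r 1) = 0.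
  rewrite (lin2_1 r) pair_expand /=.
  by rewrite !(mul0r, mulr0, addr0, mulr1, mul1r, conjC1, conjC0).
have G0B : dyad_tr (s 0) (B 0) = p.
  rewrite (lin2_0 s) pair_expand /=.
  by rewrite !(mul0r, mulr0, addr0, mulr1, mul1r, conjC1, conjC0).
have G1B : dyad_tr (s 1) (B 0) = q * (kappa ^+ 2 * e).
  rewrite (lin2_1 s) pair_expand /=.
  rewrite !(mul0r, mulr0, add0r, addr0, mulr1, mul1r, conjC1, conjC0) tc /tau /e.
  by ring.
have sA0 : sqnorm (A 0) = 1 by rewrite sA addr0.
have sA1 : sqnorm (A 1) = 2 by rewrite sA.
have swap (x y z : C) : x + y = z -> y = z - x by move=> <-; rewrite addrC addKr.
(* Terms with an outcome 1 come from marginals: summing over the outcomes of one observer replaces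
   the projectors by the identity. *)
have J01 : pair_tr (ray_test (A 0) 0) (ray_test (B 0) 1) =
    p - pair_tr (ray_test (A 0) 0) (ray_test (B 0) 0).
  apply: swap; rewrite -pair_addr ray_test_sum.
  by rewrite pair_ray_l sA0 invr1 mul1r GA0 GA1 addr0.
have J10 : pair_tr (ray_test (A 0) 1) (ray_test (B 0) 0) =
    D^-1 * (p + q * (kappa ^+ 2 * e)) - pair_tr (ray_test (A 0) 0) (ray_test (B 0) 0).
  apply: swap; rewrite -pair_addl ray_test_sum.
  by rewrite pair_ray_r sB G0B G1B.
have kD : kappa * (p + q) = 1 - kappa.
  have : kappa * (p + q + 1) = 1 by rewrite mulVf // gt_eqF.
  by rewrite mulrDr mulr1 => <-; rewrite addrK.
have e0 : 0 < e by [].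
have k0 : 0 < kappa by rewrite invr_gt0.
apply: (@weak_coherence_violation C p q e kappa D) => //.
- by rewrite (J 0 1) (GA 1) sA0 sB invr1 mul1r.
- by rewrite (J 0 0) (GA 0) sA0 sB invr1 mul1r.
- by rewrite (J 1 0) GB0 sA1 sB.
- by rewrite (J 1 1) GB1 sA1 sB.
Qed.

Lemma clauser_horne_violation : violates_local_realism rho.
Proof.
have form_ge0 v : 0 <= rho_form v v by case: rho_psd => _; apply.
have w0 := pair_weight_gt0.
apply: (expansion_violation pair_expand); rewrite ?mulr_ge0 ?(ltW w0) //.
by rewrite mulf_eq0 negb_or (gt_eqF w0) rho_form_conj conjC_eq0.
Qed.

End ClauserHorne.

(** * Steering *)

Lemma psd_ker (C : numClosedFieldType) n m (A : 'M[C]_n) (K : 'M[C]_(n, m)) :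
  A^t* = A -> (forall w : 'cV[C]_n, 0 <= (w^t* *m A *m w) 0 0) ->
  K^t* *m A *m K = 0 -> A *m K = 0.
Proof.
move=> hA pA K0; apply/matrixP => i j; rewrite [RHS]mxE.
suff /matrixP/(_ i 0) : A *m col j K = 0 by rewrite colE mulmxA -colE !mxE.
apply: psd_ker_col => //.
have -> : (col j K)^t* *m A *m col j K =
    (delta_mx j 0)^t* *m (K^t* *m A *m K) *m delta_mx j 0.
  by rewrite colE trmxCM !mulmxA.
by rewrite K0 mulmx0 mul0mx mxE.
Qed.

Lemma rank1_dyad (F : fieldType) m n (A : 'M[F]_(m, n)) : \rank A = 1%N ->
  exists (c : 'cV[F]_m) (r : 'rV[F]_n), A = c *m r.
Proof.
move=> r1; move: (col_base A) (row_base A) (mulmx_base A); rewrite r1.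
by move=> c r <-; exists c, r.
Qed.

(** A rank-one [A = c *m r] satisfies [A = A *m A^t*], a nonnegative multiple of the dyad of [c];
    idempotence then fixes the norm of the rescaled vector. *)
Lemma pure_stateP (R : realType) n (A : 'M[complex R]_n) : pure_state A ->
  exists f : 'cV[complex R]_n, A = f *m f^t* /\ (f^t* *m f) 0 0 = 1.
Proof.
case=> hA AA r1; have [c [r cr]] := rank1_dyad r1.
have /eqP hA' : A^t* == A by rewrite -hermsymE.
set t := (r *m r^t*) 0 0.
have t0 : 0 <= t by have := dot_ge0 (r^t*); rewrite trmxCK.
have AE : A = t *: (c *m c^t*).
  rewrite -AA -{2}hA' cr trmxCM mulmxA -(mulmxA c) (mx11_scalar (r *m r^t*)) -/t.
  by rewrite mul_mx_scalar scalemxAl.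
pose f := sqrtC t *: c; pose g := (f^t* *m f) 0 0.
have ff : A = f *m f^t*.
  rewrite trmxCZ -scalemxAl -scalemxAr scalerA conj_Creal ?ger0_real ?sqrtC_ge0 //.
  by rewrite -expr2 sqrtCK AE.
exists f; split=> //.
have : (g - 1) *: A = 0.
  rewrite scalerBl scale1r -{2}AA {2 3}ff mulmxA -(mulmxA f) (mx11_scalar (f^t* *m f)).
  by rewrite -/g mul_mx_scalar -scalemxAl -ff subrr.
move/eqP; rewrite scaler_eq0 subr_eq0 => /orP[/eqP //|/eqP A0].
by move: r1; rewrite A0 mxrank0.
Qed.

Section Steering.
Variables (R : realType) (N : nat) (k : 'I_N).
Local Notation C := (complex R).
Implicit Types (u v : 'cV[C]_2).

Definition restrict (s : qbasis N) : qbasis N.-1 := [ffun j => s (lift k j)].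

Lemma restrict_insert a z : restrict (insert_qubit k a z) = z.
Proof. by apply/ffunP => j; rewrite !ffunE liftK. Qed.

Lemma insert_at a z : insert_qubit k a z k = a.
Proof. by rewrite ffunE unlift_none. Qed.

Lemma insert_restrict (s : qbasis N) : insert_qubit k (s k) (restrict s) = s.
Proof.
apply/ffunP => j; rewrite ffunE; case: unliftP => [j' ->|->//].
by rewrite ffunE.
Qed.

(** The map that tensors a vector of the other qubits with [u] at qubit [k]; its adjoint contracts
    qubit [k] with [u]. *)
Definition embed u : 'M[C]_(#|{: qbasis N}|, #|{: qbasis N.-1}|) :=
  \matrix_(x, y) (u ((enum_val x : qbasis N) k) 0 *
                  (restrict (enum_val x) == enum_val y)%:R).

Lemma sum_fiber (F : 'I_2 -> C) z :
  \sum_(x < #|{: qbasis N}|) F ((enum_val x : qbasis N) k) *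
     (restrict (enum_val x) == z)%:R = \sum_a F a.
Proof.
transitivity (\sum_(s : qbasis N) F (s k) * (restrict s == z)%:R).
  rewrite [RHS](reindex (fun x : 'I_#|{: qbasis N}| => enum_val x : qbasis N)) //=.
  exact: onW_bij (enum_val_bij _).
rewrite (bigID (fun s => restrict s == z)) /= [X in _ + X]big1 ?addr0; last first.
  by move=> s /negPf ->; rewrite mulr0.
rewrite (reindex_onto (fun a => insert_qubit k a z) (fun s => s k)) /=; last first.
  by move=> s /eqP <-; rewrite insert_restrict.
apply: eq_big => a; first by rewrite restrict_insert insert_at !eqxx.
by move=> _; rewrite restrict_insert insert_at eqxx mulr1.
Qed.

Lemma embed_adj_mul u v : (embed u)^t* *m embed v = ((u^t* *m v) 0 0)%:M.
Proof.
apply/matrixP => y y'; rewrite dotE [RHS]mxE mxE.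
under eq_bigr => x _ do rewrite !mxE conjCM conjC_nat mulrACA -natrM mulnb.
have [<-|yy'] := eqVneq y y'.
  rewrite mulr1n -(sum_fiber (fun a => (u a 0)^* * v a 0) (enum_val y)).
  by apply: eq_bigr => x _; rewrite andbb.
rewrite mulr0n big1 // => x _; case: eqP => //= [->|]; last by rewrite mulr0.
by rewrite (inj_eq enum_val_inj) (negPf yy') mulr0.
Qed.

Lemma embed_mul_adj u v :
  embed u *m (embed v)^t* = local_op k (u *m v^t*).
Proof.
apply/matrixP => x y; rewrite [RHS]mxE mxE.
under eq_bigr => z _ do rewrite !mxE conjCM conjC_nat mulrACA -natrM mulnb.
rewrite -mulr_sumr (bigD1 k) //= eqxx !mxE big_ord1 !mxE; congr (_ * _).
have [xy|xy] := eqVneq (restrict (enum_val x)) (restrict (enum_val y)).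
  rewrite (bigD1 (enum_rank (restrict (enum_val x)))) //= enum_rankK xy eqxx.
  rewrite big1 ?addr0 => [|z zx]; last first.
    by rewrite andbb -(inj_eq enum_rank_inj) enum_valK eq_sym (negPf zx).
  rewrite big1 // => j jk; rewrite (negPf jk) mxE.
  move: jk; case: (unliftP k j) => [j' -> _|->]; last by rewrite eqxx.
  by move/ffunP/(_ j') : xy; rewrite !ffunE => ->; rewrite eqxx.
rewrite big1 => [|z _]; last first.
  by case: eqP => //= e1; case: eqP => //= e2; case/eqP: xy; rewrite e1 e2.
have /existsNP[j /eqP nj] : ~ forall j, enum_val x (lift k j) = enum_val y (lift k j).
  by move=> H; case/eqP: xy; apply/ffunP => j; rewrite !ffunE H.
have lk : lift k j != k by rewrite eq_sym neq_lift.
by rewrite (bigD1 (lift k j)) //= (negPf lk) mxE (negPf nj) mul0r.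
Qed.

Lemma partial_traceE X : partial_trace k X =
  \sum_a (embed (delta_mx a 0))^t* *m X *m embed (delta_mx a 0).
Proof.
have entry (a : 'I_2) (F : 'I_#|{: qbasis N}| -> C) z :
    \sum_x F x * embed (delta_mx a 0) x z = F (enum_rank (insert_qubit k a (enum_val z))).
  rewrite (bigD1 (enum_rank (insert_qubit k a (enum_val z)))) //= big1 => [|x xz].
    by rewrite !mxE enum_rankK restrict_insert insert_at !eqxx !mulr1 addr0.
  rewrite !mxE eqxx andbT; case: eqP => [xa|]; last by rewrite mul0r mulr0.
  case: eqP => [xr|]; last by rewrite !mulr0.
  by case/eqP: xz; rewrite -xa -xr insert_restrict enum_valK.
apply/matrixP => z z'; rewrite mxE summxE; apply: eq_bigr => a _.
rewrite mxE entry mxE -[LHS](entry a (fun x => X x _)).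
apply: eq_bigr => x _; rewrite mulrC; congr (_ * _).
by rewrite !mxE conjCM !conjC_nat.
Qed.

Lemma embed_sum u : embed u = \sum_a u a 0 *: embed (delta_mx a 0).
Proof.
apply/matrixP => x y; rewrite summxE mxE.
rewrite (bigD1 ((enum_val x : qbasis N) k)) //= big1 => [|a ax].
  by rewrite !mxE !eqxx mul1r addr0.
by rewrite !mxE eq_sym (negPf ax) mul0r mulr0.
Qed.

(** Rewrites an unnormalized conditional state as a compression of [X], the form in which positivity
    can be used. *)
Lemma partial_trace_local u (X : qop R N) :
  partial_trace k (local_op k (u *m u^t*) *m X) = (embed u)^t* *m X *m embed u.
Proof.
rewrite partial_traceE {2}embed_sum mulmx_sumr; apply: eq_bigr => a _.
rewrite -embed_mul_adj !mulmxA embed_adj_mul -scalemxAr !mul_scalar_mx.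
rewrite -!scalemxAl; congr (_ *: _).
rewrite dotE (bigD1 a) //= big1 => [|b ba].
  by rewrite !mxE !eqxx conjC1 mul1r addr0.
by rewrite mxE (negPf ba) conjC0 mul0r.
Qed.

Lemma local_opD (A B : 'M[C]_2) : local_op k (A + B) = local_op k A + local_op k B.
Proof. exact: tensor_opD. Qed.

Lemma local_op1 : local_op k (1%:M : 'M[C]_2) = 1%:M.
Proof.
apply/matrixP => x y; rewrite !mxE.
have [->|/eqP xy] := eqVneq x y.
  by rewrite big1 // => j _; case: (j == k); rewrite mxE eqxx.
have /existsNP[j /eqP nj] : ~ forall j, (enum_val x : qbasis N) j = (enum_val y : qbasis N) j.
  by move=> /ffunP /enum_val_inj.
by rewrite (bigD1 j) //=; case: (j == k); rewrite mxE (negPf nj) mul0r.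
Qed.

(* Positivity of [rho] forces its off-diagonal blocks to be carried by the two
   pure conditional states, so [rho] lives on the span of the [e a]. *)
Lemma steering_frame (rho : qop R N) : psd rho -> can_steer rho k ->
  exists (u : 'I_2 -> 'cV[C]_2) (e : 'I_2 -> 'cV[C]_#|{: qbasis N}|),
  [/\ orthonormal_family u, orthonormal_family e,
      forall a, local_op k (u a *m (u a)^t*) *m e a = e a,
      rho *m (e 0 *m (e 0)^t* + e 1 *m (e 1)^t*) = rho
    & forall a, ((e a)^t* *m rho *m e a) 0 0 != 0].
Proof.
case=> hrho prho [P [[u [ou PE]] pN0 pure _]].
have /eqP rho_adj : rho^t* == rho by rewrite -hermsymE.
have {}ou : orthonormal_family u by move=> a b; rewrite ou mxE mulr1n.
pose V a := embed (u a); pose p a := outcome_prob rho k P a.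
have /choice[f fP] : forall a, exists f : 'cV[C]_#|{: qbasis N.-1}|,
    (V a)^t* *m rho *m V a = p a *: (f *m f^t*) /\ (f^t* *m f) 0 0 = 1.
  move=> a; have [f [fE f1]] := pure_stateP (pure a); exists f; split=> //.
  rewrite -fE /conditional_state PE partial_trace_local scalerA mulfV ?scale1r //.
  exact/eqP/pN0.
have VV a b : (V a)^t* *m V b = (a == b)%:R%:M by rewrite embed_adj_mul ou.
pose e a := V a *m f a.
have ee a b : ((e a)^t* *m e b) 0 0 = (a == b)%:R.
  rewrite trmxCM mulmxA -(mulmxA _ _ (V b)) VV mul_mx_scalar -scalemxAl scale11.
  by case: eqP => [<-|_]; rewrite ?mul0r // mul1r; case: (fP a).
exists u, e; split=> //.
- move=> a; rewrite -embed_mul_adj -/(V a) /e mulmxA -(mulmxA (V a)) VV eqxx.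
  by rewrite mulmx1.
(* The compression of [rho] by [V a] is a multiple of the projector [F], so the columns of
   [V a *m (F - 1%:M)] are isotropic and [rho] kills them. Summing over [a] then uses completeness
   of the basis [u]. *)
- have Ve a : rho *m (e a *m (e a)^t*) = rho *m (V a *m (V a)^t*).
    have [fE f1] := fP a; set F := f a *m (f a)^t* in fE.
    have FF : F *m F = F.
      rewrite /F mulmxA -(mulmxA (f a)) (mx11_scalar ((f a)^t* *m f a)) f1.
      by rewrite mulmx1.
    have Fadj : F^t* = F by rewrite trmxCM trmxCK.
    have : rho *m (V a *m F - V a) = 0.
      apply: psd_ker => //.
      have -> : V a *m F - V a = V a *m (F - 1%:M) by rewrite mulmxBr mulmx1.
      have -> : (V a *m (F - 1%:M))^t* *m rho *m (V a *m (F - 1%:M)) =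
          (F - 1%:M)^t* *m ((V a)^t* *m rho *m V a *m (F - 1%:M)).
        by rewrite trmxCM !mulmxA.
      by rewrite fE -scalemxAl mulmxBr FF mulmx1 subrr scaler0 mulmx0.
    move/eqP; rewrite mulmxBr subr_eq0 => /eqP VF.
    by rewrite /e trmxCM !mulmxA -(mulmxA (rho *m V a)) -/F -(mulmxA rho) VF.
  rewrite mulmxDr !Ve -mulmxDr !embed_mul_adj -local_opD.
  by rewrite orthonormal_complete // local_op1 mulmx1.
- move=> a; have [fE f1] := fP a.
  have -> : (e a)^t* *m rho *m e a = p a *: ((f a)^t* *m f a *m ((f a)^t* *m f a)).
    have -> : (e a)^t* *m rho *m e a = (f a)^t* *m ((V a)^t* *m rho *m V a) *m f a.
      by rewrite /e trmxCM !mulmxA.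
    by rewrite fE -scalemxAr -scalemxAl !mulmxA.
  rewrite scale11 mul11 f1 !mulr1; exact/eqP/pN0.
Qed.

End Steering.

(** * Operators supported on two vectors *)

Section Frames.
Variables (C : numClosedFieldType) (n : nat) (A : 'M[C]_n) (e : 'I_2 -> 'cV[C]_n).
Hypotheses (hA : A^t* = A) (oe : orthonormal_family e).
Hypothesis Ae : A *m (e 0 *m (e 0)^t* + e 1 *m (e 1)^t*) = A.

Definition coef a b := ((e a)^t* *m A *m e b) 0 0.

Lemma coef_conj a b : coef a b = (coef b a)^*.
Proof. by rewrite /coef -trmxCE !trmxCM trmxCK hA mulmxA. Qed.

Lemma frame_projl : (e 0 *m (e 0)^t* + e 1 *m (e 1)^t*) *m A = A.
Proof. by rewrite -{2}hA -{2}Ae trmxCM trmxCD !trmxCM !trmxCK hA. Qed.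

Lemma frame_mul a : A *m e a = coef 0 a *: e 0 + coef 1 a *: e 1.
Proof.
rewrite -{1}frame_projl -mulmxA mulmxDl -!mulmxA !(mulmxA _ A).
by rewrite (mx11_scalar (_ *m A *m e a)) (mx11_scalar ((e 1)^t* *m A *m e a)) !mul_mx_scalar.
Qed.

Lemma frame_expand : A = coef 0 0 *: (e 0 *m (e 0)^t*) + coef 1 0 *: (e 1 *m (e 0)^t*)
  + (coef 0 1 *: (e 0 *m (e 1)^t*) + coef 1 1 *: (e 1 *m (e 1)^t*)).
Proof. by rewrite -{1}Ae mulmxDr !mulmxA !frame_mul !mulmxDl -!scalemxAl. Qed.

Lemma frame_form (y z : 'cV[C]_n) : (y^t* *m A *m z) 0 0 =
  \sum_a \sum_b coef a b * ((y^t* *m e a) 0 0 * ((e b)^t* *m z) 0 0).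
Proof.
rewrite {1}frame_expand !mulmxDr !mulmxDl -!scalemxAr -!scalemxAl !(add11, scale11).
rewrite !mulmxA -!(mulmxA (y^t* *m _)) !mul11.
by rewrite !sum_ord2 addrACA.
Qed.

(** A singular two-by-two coefficient matrix is determined by its first column, up to the pivot
    [coef 0 0]. *)
Lemma frame_degenerate : coef 0 0 != 0 -> coef 0 0 * coef 1 1 = coef 0 1 * coef 1 0 ->
  A = (coef 0 0)^-1 *: ((A *m e 0) *m (A *m e 0)^t*).
Proof.
move=> c0 det0; rewrite {1}frame_expand frame_mul trmxCD !trmxCZ -!coef_conj.
rewrite !mulmxDl !mulmxDr -!scalemxAl -!scalemxAr !scalerA !scalerDr !scalerA.
rewrite !mulrA !mulVf // !mul1r.
have -> : (coef 0 0)^-1 * coef 1 0 * coef 0 0 = coef 1 0 by rewrite mulrAC mulVf ?mul1r.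
have -> : (coef 0 0)^-1 * coef 1 0 * coef 0 1 = coef 1 1.
  by rewrite -mulrA (mulrC (coef 1 0)) -det0 mulKf.
by rewrite addrACA.
Qed.

(** Cramer's rule puts each [e a] in the range of [A], hence in the span of any other frame carrying
    [A]. *)
Lemma frame_nondegenerate : coef 0 0 * coef 1 1 != coef 0 1 * coef 1 0 ->
  forall a, exists w, e a = A *m w.
Proof.
rewrite -subr_eq0; set d := _ - _ => d0 a.
have [->|->] := ord2P a.
  exists (d^-1 *: (coef 1 1 *: e 0 - coef 1 0 *: e 1)).
  rewrite -scalemxAr mulmxBr -!scalemxAr !frame_mul.
  have -> : coef 1 1 *: (coef 0 0 *: e 0 + coef 1 0 *: e 1)
      - coef 1 0 *: (coef 0 1 *: e 0 + coef 1 1 *: e 1) = d *: e 0.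
    rewrite !scalerDr !scalerA opprD addrACA -!scalerBl (mulrC (coef 1 1) (coef 1 0)).
    by rewrite subrr scale0r addr0 (mulrC (coef 1 1)) (mulrC (coef 1 0)).
  by rewrite scalerA mulVf // scale1r.
exists (d^-1 *: (coef 0 0 *: e 1 - coef 0 1 *: e 0)).
rewrite -scalemxAr mulmxBr -!scalemxAr !frame_mul.
have -> : coef 0 0 *: (coef 0 1 *: e 0 + coef 1 1 *: e 1)
    - coef 0 1 *: (coef 0 0 *: e 0 + coef 1 0 *: e 1) = d *: e 1.
  rewrite !scalerDr !scalerA opprD addrACA -!scalerBl (mulrC (coef 0 0) (coef 0 1)).
  by rewrite subrr scale0r add0r.
by rewrite scalerA mulVf // scale1r.
Qed.

End Frames.

(** * Mixtures of product vectors are fully separable *)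

Section Separability.
Variables (R : realType) (N : nat).
Local Notation C := (complex R).

Lemma trace_tensor (A : 'I_N -> 'M[C]_2) : \tr (tensor_op A) = \prod_k \tr (A k).
Proof.
rewrite /mxtrace -(sum_qbasis (fun k b => A k b b)).
by apply: eq_bigr => x _; rewrite mxE.
Qed.

Lemma ray_density (v : 'cV[C]_2) : v != 0 -> density (ray v).
Proof.
move=> v0; have n0 : sqnorm v != 0 by rewrite /sqnorm dot_eq0.
have nge : 0 <= sqnorm v by exact: dot_ge0.
have ni : 0 <= (sqnorm v)^-1 by rewrite invr_ge0.
split; first split.
- rewrite hermsymE /ray trmxCZ trmxCM trmxCK conj_Creal //.
  exact: ger0_real.
- move=> x; rewrite /ray -scalemxAr -scalemxAl scale11 mulr_ge0 //.
  have -> : x^t* *m (v *m v^t*) *m x = (x^t* *m v) *m (v^t* *m x) by rewrite !mulmxA.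
  by rewrite mul11 (dot_conj x v) mulrC mul_conjC_ge0.
- by rewrite /ray mxtraceZ mxtrace_mulC trace_mx11 -/(sqnorm v) mulVf.
Qed.

Lemma prodvec_eq0 (y : 'I_N -> 'cV[C]_2) k : y k = 0 -> prodvec y = 0.
Proof.
move=> y0; apply/matrixP => a b; rewrite !mxE (bigD1 k) //= y0 mxE.
exact: mul0r.
Qed.

Lemma product_dyad (y : 'I_N -> 'cV[C]_2) c : (forall k, y k != 0) ->
  (c *: prodvec y) *m (c *: prodvec y)^t* =
  (c * c^* * \prod_k sqnorm (y k)) *: tensor_op (fun k => ray (y k)).
Proof.
move=> y0; rewrite trmxCZ -scalemxAl -scalemxAr scalerA prodvec_adj -[RHS]scalerA.
congr (_ *: _); rewrite -tensor_opZ; congr tensor_op; apply/funext => k.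
by rewrite /ray scalerA mulfV ?scale1r // /sqnorm dot_eq0.
Qed.

Lemma separable_mixture m (rho : qop R N) (c : 'I_m -> C)
    (e : 'I_m -> 'cV[C]_#|{: qbasis N}|) :
  \tr rho = 1 -> rho = \sum_i c i *: (e i *m (e i)^t*) ->
  (forall i, 0 <= c i) -> (forall i, e i != 0) ->
  (forall i, exists z y, e i = z *: prodvec y) ->
  fully_separable rho.
Proof.
move=> tr1 rhoE c0 e0 prod.
have /choice[zy zyE] : forall i, exists zy : C * ('I_N -> 'cV[C]_2),
    e i = zy.1 *: prodvec zy.2.
  by move=> i; have [z [y E]] := prod i; exists (z, y).
pose y i := (zy i).2; pose z i := (zy i).1.
have y0 i k : y i k != 0.
  by apply: contraNneq (e0 i) => yk; rewrite zyE (prodvec_eq0 yk) scaler0.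
(* The weights absorb all squared norms, so that each tensor factor is a density; trace one then
   makes them sum to 1. *)
pose W i : C := c i * (z i * (z i)^* * \prod_k sqnorm (y i k)).
have W0 i : 0 <= W i.
  apply: mulr_ge0; first exact: c0.
  apply: mulr_ge0; first exact: mul_conjC_ge0.
  by apply: prodr_ge0 => k _; exact: dot_ge0.
have ReW i : (complex.Re (W i))%:C%C = W i by rewrite RRe_real // ger0_real.
have rhoW : rho = \sum_i W i *: tensor_op (fun k => ray (y i k)).
  rewrite rhoE; apply: eq_bigr => i _.
  by rewrite zyE product_dyad ?scalerA //; exact: y0.
exists m, (fun i => complex.Re (W i)), (fun i k => ray (y i k)); split.
- by move=> i; have := W0 i; rewrite -ReW ler0c.
- apply: (@complexI R); rewrite rmorph_sum rmorph1 /=.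
  under eq_bigr => i _ do rewrite ReW.
  rewrite -tr1 rhoW raddf_sum /=; apply: eq_bigr => i _.
  rewrite mxtraceZ trace_tensor big1 ?mulr1 // => k _.
  by case: (ray_density (y0 i k)).
- by move=> i k; exact: ray_density.
- by rewrite [LHS]rhoW; apply: eq_bigr => i _; rewrite ReW.
Qed.

End Separability.

(** * Violation from an entangled pure component *)

(** An invertible diagonal matrix has rank two, a product table at most one. *)
Lemma diagonal_not_product (K : fieldType) (f g : 'I_2 -> K) :
  ~ (forall a b, (f a * g b == 0) = (a != b)).
Proof.
move=> H; have := H 0 0; have := H 1 1; have := H 0 1; rewrite !mulf_eq0 /=.
by case: (f 0 == 0) => //=; case: (g 1 == 0); rewrite ?orbT.
Qed.

Lemma upd_on_pair_l N (i j : 'I_N) T (x : 'I_N -> T) v w z : i != j ->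
  upd (on_pair i j x v w) i z = on_pair i j x z w.
Proof. by move=> ij; rewrite /on_pair -updC // upd_upd. Qed.

Lemma upd_on_pair_r N (i j : 'I_N) T (x : 'I_N -> T) v w z :
  upd (on_pair i j x v w) j z = on_pair i j x v z.
Proof. by rewrite /on_pair upd_upd. Qed.

Lemma upd_on_pair_out N (i j k : 'I_N) T (x : 'I_N -> T) v w z :
  k != i -> k != j ->
  upd (on_pair i j x v w) k z = on_pair i j (upd x k z) v w.
Proof.
by move=> ki kj; apply/funext => l; rewrite /on_pair /upd; case: (eqVneq l k) => [->|//];
  rewrite (negPf ki) (negPf kj).
Qed.

Section Violation.
Variables (R : realType) (N : nat).
Local Notation C := (complex R).
Implicit Types (e : 'cV[C]_#|{: qbasis N}|) (x : 'I_N -> 'cV[C]_2).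

Lemma amp_conj e x : (e^t* *m prodvec x) 0 0 = (amp e x)^*.
Proof. by rewrite /amp dot_conj. Qed.

(** The local operator fixing [e] is self-adjoint and can act on the product vector instead, where
    it turns slot [k] into a multiple of [u]. *)
Lemma amp_local e k u x : local_op k (u *m u^t*) *m e = e ->
  amp e x = ((x k)^t* *m u) 0 0 * amp e (upd x k u).
Proof.
move=> ue; rewrite /amp -{1}ue mulmxA.
have -> : (prodvec x)^t* *m local_op k (u *m u^t*) =
    (((u^t* *m x k) 0 0) *: prodvec (upd x k u))^t*.
  rewrite -prodvec_updZ.
  have -> : upd x k ((u^t* *m x k) 0 0 *: u) =
      (fun j => (if j == k then u *m u^t* else 1%:M) *m x j).
    apply/funext => j; rewrite /upd; case: eqP => [->|_]; last by rewrite mul1mx.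
    by rewrite -mulmxA (mx11_scalar (u^t* *m x k)) mul_mx_scalar !mxE eqxx mulr1n.
  rewrite -mul_tensor_prodvec trmxCM /local_op tensor_op_adj; congr (_ *m tensor_op _).
  apply/funext => j; case: (j == k); last by rewrite trmxC1.
  by rewrite trmxCM trmxCK.
by rewrite trmxCZ -scalemxAl scale11 -dot_conj.
Qed.

(** [rho] is asked to act as a dyad only on the four pair vectors, so that mixtures whose other
    branch is projected out are covered. *)
Lemma dyad_violation (rho : qop R N) e c (i j : 'I_N) x (s r : 'I_2 -> 'cV[C]_2) :
  psd rho -> c != 0 -> i != j -> orthonormal_family s -> orthonormal_family r ->
  (forall a b, (amp e (on_pair i j x (s a) (r b)) == 0) = (a != b)) ->
  (forall a b, rho *m prodvec (on_pair i j x (s a) (r b)) =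
     c *: (e *m (e^t* *m prodvec (on_pair i j x (s a) (r b))))) ->
  violates_local_realism rho.
Proof.
move=> hrho c0 ij os or ampE rhoE.
have formE a b a' b' : rho_form rho (pair_vec i j x s r a b) (pair_vec i j x s r a' b') =
    c * (amp e (on_pair i j x (s a) (r b)) * (amp e (on_pair i j x (s a') (r b')))^*).
  rewrite /rho_form /pair_vec -mulmxA rhoE -scalemxAr scale11 mulmxA mul11.
  by rewrite amp_conj.
apply: (clauser_horne_violation (w := x) hrho ij os or); rewrite formE.
- by have /eqP -> := ampE 0 1; rewrite mul0r mulr0.
- by have /eqP -> := ampE 1 0; rewrite mul0r mulr0.
- by rewrite !mulf_eq0 negb_or c0 negb_or conjC_eq0 !ampE.
Qed.

Lemma entangled_dyad_violation (rho : qop R N) e c :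
  psd rho -> c != 0 -> e != 0 -> rho = c *: (e *m e^t*) ->
  (forall z y, e != z *: prodvec y) -> violates_local_realism rho.
Proof.
move=> hrho c0 e0 rhoE ent.
have [i [j [x [s [r [ij os or ampE]]]]]] := entangled_singular_vectors e0 ent.
apply: (dyad_violation (x := x) (c := c) (e := e) hrho c0 ij os or ampE) => a b.
by rewrite rhoE -scalemxAl mulmxA.
Qed.

(** Qubit [k] factors out of [e], so it is not in the entangled pair; projecting it on [u] removes
    [e'], since [u'] is orthogonal to [u]. *)
Lemma entangled_branch_violation (rho : qop R N) e e' c c' k (u u' : 'cV[C]_2) :
  psd rho -> c != 0 -> e != 0 -> (u'^t* *m u) 0 0 = 0 ->
  local_op k (u *m u^t*) *m e = e -> local_op k (u' *m u'^t*) *m e' = e' ->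
  rho = c *: (e *m e^t*) + c' *: (e' *m e'^t*) ->
  (forall z y, e != z *: prodvec y) -> violates_local_realism rho.
Proof.
move=> hrho c0 e0 uu' ue ue' rhoE ent.
have [i [j [x [s [r [ij os or ampE]]]]]] := entangled_singular_vectors e0 ent.
have F a b := amp_local (on_pair i j x (s a) (r b)) ue.
have ki : k != i.
  apply/eqP => ki; subst k.
  apply: (@diagonal_not_product C (fun a => ((s a)^t* *m u) 0 0)
    (fun b => amp e (on_pair i j x u (r b)))) => a b.
  rewrite -(ampE a b) (F a b) (on_pair_l _ _ _ ij) (upd_on_pair_l _ _ _ _ ij).
  exact: erefl.
have kj : k != j.
  apply/eqP => kj; subst k.
  apply: (@diagonal_not_product C (fun b => ((r b)^t* *m u) 0 0)
    (fun a => amp e (on_pair i j x (s a) u))) => b a.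
  rewrite [b == a]eq_sym -(ampE a b) (F a b) on_pair_r upd_on_pair_r.
  exact: erefl.
have {}F a b : amp e (on_pair i j x (s a) (r b)) =
    ((x k)^t* *m u) 0 0 * amp e (on_pair i j (upd x k u) (s a) (r b)).
  by rewrite (F a b) (on_pair_out _ _ _ ki kj) (upd_on_pair_out _ _ _ _ ki kj).
apply: (dyad_violation (x := upd x k u) (c := c) (e := e) hrho c0 ij os or) => a b.
  have := ampE 0 0; rewrite (F 0 0) mulf_eq0 => /norP[xu _].
  by rewrite -(ampE a b) (F a b) mulf_eq0 (negPf xu).
rewrite rhoE mulmxDl -!scalemxAl -!mulmxA.
have -> : e'^t* *m prodvec (on_pair i j (upd x k u) (s a) (r b)) = 0.
  apply/matrixP => p q; rewrite !ord1 amp_conj [RHS]mxE.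
  rewrite -(upd_on_pair_out x (s a) (r b) u ki kj) (amp_local _ ue').
  rewrite upd_same dot_conj uu' conjC0 mul0r.
  exact: conjC0.
by rewrite mulmx0 scaler0 addr0.
Qed.

End Violation.

(** * Two steering observers *)

Section TwoSteering.
Variables (R : realType) (N : nat) (k l : 'I_N).
Local Notation C := (complex R).
Implicit Types (rho : qop R N) (u v : 'I_2 -> 'cV[C]_2).
Implicit Types (e f : 'I_2 -> 'cV[C]_#|{: qbasis N}|).

Lemma local_op_mul i (A B : 'M[C]_2) :
  local_op i A *m local_op i B = local_op (N := N) i (A *m B).
Proof.
rewrite /local_op mul_tensor_op; congr tensor_op; apply/funext => j.
by case: (j == i); rewrite ?mulmx1.
Qed.

Lemma local_op_commute (A B : 'M[C]_2) : k != l ->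
  local_op (N := N) k A *m local_op l B = local_op l B *m local_op k A.
Proof.
move=> kl; rewrite /local_op !mul_tensor_op; congr tensor_op; apply/funext => j.
case: (eqVneq j k) => [->|_]; first by rewrite (negPf kl) mulmx1 mul1mx.
by case: (j == l); rewrite ?mulmx1 ?mul1mx.
Qed.

Lemma local_op_kill i u e a b : orthonormal_family u ->
  local_op i (u b *m (u b)^t*) *m e b = e b -> a != b ->
  local_op i (u a *m (u a)^t*) *m e b = 0.
Proof.
move=> ou <- ab; rewrite mulmxA local_op_mul.
have -> : u a *m (u a)^t* *m (u b *m (u b)^t*) = 0.
  rewrite mulmxA -(mulmxA (u a)) (mx11_scalar ((u a)^t* *m u b)) ou (negPf ab).
  by rewrite mul_mx_scalar scale0r mul0mx.
have -> : local_op i (0 : 'M[C]_2) = 0 :> qop R N.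
  by have := tensor_op_updZ (fun=> 1%:M) i 0 (0 : 'M[C]_2); rewrite !scale0r.
exact: mul0mx.
Qed.

(* A vector fixed by a local projector of observer [k] that expands on both
   [f 0] and [f 1] would force both of them to be killed by the other
   projector of [k], and hence every vector of their span. *)
Lemma matching_frames u v e f : k != l ->
  orthonormal_family u -> orthonormal_family v ->
  orthonormal_family e -> orthonormal_family f ->
  (forall a, local_op k (u a *m (u a)^t*) *m e a = e a) ->
  (forall b, local_op l (v b *m (v b)^t*) *m f b = f b) ->
  (forall a, e a = f 0 *m ((f 0)^t* *m e a) + f 1 *m ((f 1)^t* *m e a)) ->
  exists g : 'I_2 -> 'I_2, injective g /\
    forall a, local_op l (v (g a) *m (v (g a))^t*) *m e a = e a.
Proof.
move=> kl ou ov oe of_ ue vf span.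
pose t b a := ((f b)^t* *m e a) 0 0.
have {}span a : e a = t 0 a *: f 0 + t 1 a *: f 1.
  rewrite {1}span (mx11_scalar ((f 0)^t* *m e a)) (mx11_scalar ((f 1)^t* *m e a)).
  by rewrite !mul_mx_scalar.
have e_neq0 a : e a != 0 by rewrite -dot_eq0 oe eqxx oner_eq0.
(* In ['I_2], [1 - b] is the other index. *)
have one a : exists b, t (1 - b) a = 0.
  apply/not_existsP => H.
  have t0 b : t b a != 0 by apply/eqP => tb; apply: (H (1 - b)); rewrite subKr.
  pose A' := local_op (N := N) k (u (1 - a) *m (u (1 - a))^t*).
  have na : 1 - a != a by case: (ord2P a) => ->.
  have A'e : A' *m e a = 0 by exact: (local_op_kill ou (ue a)).
  have A'f b : A' *m f b = 0.
    (* [B b] isolates the [f b] component of [e a] and commutes with [A'], which kills [e a]; hence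
       [A'] kills [f b]. *)
    pose B b := local_op (N := N) l (v b *m (v b)^t*).
    have Bf c : B b *m f c = (b == c)%:R *: f c.
      have [<-|bc] := eqVneq b c; first by rewrite vf scale1r.
      by rewrite (local_op_kill ov (vf c) bc) scale0r.
    have : B b *m (A' *m e a) = 0 by rewrite A'e mulmx0.
    rewrite mulmxA -(local_op_commute _ _ kl) -mulmxA span mulmxDr -!scalemxAr !Bf.
    case: (ord2P b) => -> /=; rewrite scale1r scale0r scaler0 ?addr0 ?add0r -scalemxAr;
      by move/eqP; rewrite scaler_eq0 (negPf (t0 _)) => /eqP.
  have := e_neq0 (1 - a); rewrite -ue -/A' span mulmxDr -!scalemxAr !A'f.
  by rewrite !scaler0 addr0 eqxx.
have /choice[g gP] := one.
have eg a : e a = t (g a) a *: f (g a).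
  have := gP a; rewrite {1}span; case: (ord2P (g a)) => ->.
    by rewrite subr0 => ->; rewrite scale0r addr0.
  by rewrite subrr => ->; rewrite scale0r add0r.
exists g; split; last by move=> a; rewrite eg -scalemxAr vf.
(* If [g] took one value twice, the orthogonal unit vectors [e a] and [e b] would be parallel. *)
move=> a b gab; apply/eqP; apply: contraT => ab.
have := oe a b; rewrite (negPf ab) (eg a) (eg b) gab trmxCZ -scalemxAl -scalemxAr.
rewrite !scale11 of_ eqxx mulr1 => /eqP; rewrite mulf_eq0 conjC_eq0.
by case/orP => /eqP t0; [have := e_neq0 a | have := e_neq0 b];
  rewrite eg ?gab t0 scale0r eqxx.
Qed.

End TwoSteering.

(** * Rank two with coherence between the branches *)

Section CoherentFrame.
Variables (R : realType) (N : nat) (k l : 'I_N).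
Local Notation C := (complex R).

(** [common_nonzero_family] gives one product vector overlapping both [e 0] and [e 1]. With [u] and
    [r] in slots [k] and [l], the pair vector 00 meets only [e 0], 11 only [e 1], and 01 and 10
    neither, so the coherence is a nonzero multiple of [coef rho e 0 1]. *)
Lemma coherent_violation (rho : qop R N) (u r : 'I_2 -> 'cV[C]_2)
    (e : 'I_2 -> 'cV[C]_#|{: qbasis N}|) :
  psd rho -> rho^t* = rho -> k != l ->
  orthonormal_family u -> orthonormal_family r -> orthonormal_family e ->
  rho *m (e 0 *m (e 0)^t* + e 1 *m (e 1)^t*) = rho ->
  (forall a, local_op k (u a *m (u a)^t*) *m e a = e a) ->
  (forall a, local_op l (r a *m (r a)^t*) *m e a = e a) ->
  coef rho e 0 1 != 0 -> violates_local_realism rho.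
Proof.
move=> hrho rho_adj kl ou or oe rhoe ue re c01.
have amp_e a x : amp (e a) x = ((x k)^t* *m u a) 0 0 * ((x l)^t* *m r a) 0 0
    * amp (e a) (on_pair k l x (u a) (r a)).
  rewrite (amp_local x (ue a)) (amp_local (upd x k (u a)) (re a)) -mulrA.
  by rewrite upd_other // eq_sym.
have ampD' a : slot_additive (amp (e a)) by move=> x i v w; exact: ampD.
have nonzero a : exists x, amp (e a) x != 0.
  apply/not_existsP => H.
  have : e a = 0.
    apply/matrixP => i j; rewrite ord1 -amp_basis mxE; apply/eqP/negPn/negP.
    exact: H.
  by apply/eqP; rewrite -dot_eq0 oe eqxx oner_eq0.
have [x0 hx0] := nonzero 0; have [x1 hx1] := nonzero 1.
have [x [h0 h1]] := common_nonzero_family (ampD' 0) (ampD' 1) hx0 hx1.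
have amp_diag c : amp (e c) (on_pair k l x (u c) (r c)) != 0.
  have : amp (e c) x != 0 by have [->|->] := ord2P c; [exact: h0 | exact: h1].
  by rewrite (amp_e c x) mulf_eq0 => /norP[].
have ampX c a b : ((pair_vec k l x u r a b)^t* *m e c) 0 0 =
    (a == c)%:R * (b == c)%:R * amp (e c) (on_pair k l x (u c) (r c)).
  have := amp_e c (on_pair k l x (u a) (r b)).
  rewrite (on_pair_l _ _ _ kl) on_pair_r ou or => E.
  rewrite /pair_vec -/(amp _ _) E; congr (_ * amp _ _).
  by rewrite /on_pair (updC _ _ _ kl) upd_upd -(updC _ _ _ kl) upd_upd.
have [X XE] : exists X, X = pair_vec k l x u r by exists (pair_vec k l x u r).
have [h hE] : exists h, h = fun c => amp (e c) (on_pair k l x (u c) (r c)).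
  by exists (fun c => amp (e c) (on_pair k l x (u c) (r c))).
have {}ampX c a b : ((X a b)^t* *m e c) 0 0 = (a == c)%:R * (b == c)%:R * h c.
  by rewrite XE hE; exact: ampX.
have h_neq0 c : h c != 0 by rewrite hE; exact: amp_diag.
clear hE.
have eX c a b : ((e c)^t* *m X a b) 0 0 = (a == c)%:R * (b == c)%:R * (h c)^*.
  rewrite dot_conj ampX !conjCM; congr (_ * _ * _); exact: conjC_nat.
have formX a b a' b' : rho_form rho (X a b) (X a' b') = \sum_c \sum_c' coef rho e c c' *
    ((a == c)%:R * (b == c)%:R * h c * ((a' == c')%:R * (b' == c')%:R * (h c')^*)).
  rewrite /rho_form (frame_form rho_adj rhoe); apply: eq_bigr => c _.
  by apply: eq_bigr => c' _; rewrite ampX eX.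
have off a b : a != b -> rho_form rho (X a b) (X a b) = 0.
  move=> ab; have z c : (a == c)%:R * (b == c)%:R = 0 :> C.
    by have [<-|_] := eqVneq a c; rewrite ?mul0r // eq_sym (negPf ab) mulr0.
  by rewrite formX big1 // => c _; rewrite big1 // => c' _; rewrite z !mul0r mulr0.
have diag : rho_form rho (X 0 0) (X 1 1) != 0.
  rewrite formX !sum_ord2 /= !(mul0r, mulr0, mul1r, addr0, add0r).
  by rewrite !mulf_eq0 conjC_eq0 !negb_or c01 !h_neq0.
have off01 := off 0 1 isT; have off10 := off 1 0 isT.
rewrite XE in off01 off10 diag.
exact: (clauser_horne_violation hrho kl ou or off01 off10 diag).
Qed.

End CoherentFrame.

Theorem theorem2 (R : realType) (N : nat) (rho : qop R N)
    (hN : (2 <= N)%N) (hrho : density rho) (hent : entangled rho)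
    (hsteer : exists k l : 'I_N, k <> l /\ can_steer rho k /\ can_steer rho l) :
  violates_local_realism rho.
Proof.
have [rho_psd tr1] := hrho.
have /eqP rho_adj : rho^t* == rho by rewrite -hermsymE; case: rho_psd.
have [k [l [/eqP kl [stk stl]]]] := hsteer.
have [u [e [ou oe ue rhoe en0]]] := steering_frame rho_psd stk.
have [v [f [ov of_ vf rhof _]]] := steering_frame rho_psd stl.
have e0 a : e a != 0 by rewrite -dot_eq0 oe eqxx oner_eq0.
have c_ge0 a : 0 <= coef rho e a a by case: rho_psd => _; apply.
(* Zero determinant is the pure case: [rho] is a multiple of the dyad of [rho *m e 0], which is not
   a product vector because [rho] is entangled. *)
have [det0|det1] := eqVneq (coef rho e 0 0 * coef rho e 1 1)
                           (coef rho e 0 1 * coef rho e 1 0).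
  have rhoE := frame_degenerate rho_adj rhoe (en0 0) det0.
  have psi0 : rho *m e 0 != 0.
    by apply: contraNneq (en0 0) => re; rewrite -mulmxA re mulmx0 mxE.
  have [prod|ent] := pselect (exists z y, rho *m e 0 = z *: prodvec y).
    case: hent; apply: (@separable_mixture R N 1 rho (fun=> (coef rho e 0 0)^-1)
      (fun=> rho *m e 0)) => // [|i]; first by rewrite big_ord1.
    by rewrite invr_ge0.
  apply: (entangled_dyad_violation rho_psd _ psi0 rhoE); first by rewrite invr_eq0 en0.
  by move=> z y; apply/eqP => E; apply: ent; exists z, y.
(* In rank two, [e a] lies in the range of [rho], on which the projector of the frame [f] acts as
   the identity. *)
have span a : e a = f 0 *m ((f 0)^t* *m e a) + f 1 *m ((f 1)^t* *m e a).
  have [w ->] := frame_nondegenerate rho_adj rhoe det1 a.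
  by rewrite -{1}(frame_projl rho_adj rhof) -mulmxA mulmxDl !mulmxA.
have [g [ginj ve]] := matching_frames kl ou ov oe of_ ue vf span.
have [c01|c01] := eqVneq (coef rho e 0 1) 0; last first.
  apply: (@coherent_violation _ _ k l rho u (fun a => v (g a)) e) => //.
  by move=> a b; rewrite ov (inj_eq ginj).
have c10 : coef rho e 1 0 = 0 by rewrite coef_conj // c01 conjC0.
have rhoE : rho = coef rho e 0 0 *: (e 0 *m (e 0)^t*)
                + coef rho e 1 1 *: (e 1 *m (e 1)^t*).
  by rewrite {1}(frame_expand rho_adj rhoe) c01 c10 !scale0r addr0 add0r.
have branch a b : a != b -> rho = coef rho e a a *: (e a *m (e a)^t*)
    + coef rho e b b *: (e b *m (e b)^t*) ->
    (forall z y, e a != z *: prodvec y) -> violates_local_realism rho.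
  move=> ab E; apply: (entangled_branch_violation rho_psd (en0 a) (e0 a) _ (ue a) (ue b) E).
  by rewrite ou eq_sym (negPf ab).
(* Without coherence [rho] is a mixture of [e 0] and [e 1]; it would be separable if both were
   product vectors. *)
have [prod|/existsNP[a Ha]] := pselect (forall a, exists z y, e a = z *: prodvec y).
  case: hent; apply: (separable_mixture (c := fun a => coef rho e a a) tr1) prod => //.
  by rewrite sum_ord2.
apply: (branch a (1 - a)).
- by case: (ord2P a) => ->.
- case: (ord2P a) => ->; first by rewrite subr0; exact: rhoE.
  by rewrite subrr addrC; exact: rhoE.
- by move=> z y; apply/eqP => E; apply: Ha; exists z, y.
Qed.
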